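(* Let $K$ be a weakly$^*$ compact subset of $C_0[0,\omega_1)^*$. Then exactly one of the following two alternatives holds: (I) $K$ (with the weak$^*$ topology) is uniformly Eberlein compact; or (II) $K$ contains a homeomorphic copy of $[0,\omega_1]$ of the form $\{\rho+\lambda\delta_\alpha:\alpha\in D\}\cup\{\rho\}$, where $\rho\in C_0[0,\omega_1)^*$, $\lambda$ is a non-zero scalar, $\delta_\alpha$ is the point evaluation at $\alpha$, and $D$ is a closed and unbounded subset of $[0,\omega_1)$.
   Context: Scalars are in $\mathbb{K}=\mathbb{R}$ or $\mathbb{K}=\mathbb{C}$. $\omega_1$ is the first uncountable ordinal; ordinal intervals carry the order topology. $C_0[0,\omega_1)$ is the Banach space (supremum norm) of continuous functions $f\colon[0,\omega_1)\to\mathbb{K}$ that vanish eventually (i.e. $f(\alpha)=0$ for all sufficiently large $\alpha<\omega_1$), and $C_0[0,\omega_1)^*$ is its dual space. A topological space is uniformly Eberlein compact if it is homeomorphic to a weakly compact subset of a Hilbert space. A subset $D$ of $[0,\omega_1)$ is closed and unbounded if it is closed in the order topology of $[0,\omega_1)$ and unbounded (equivalently, uncountable). The copy in (II) carries the relative weak$^*$ topology. *)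

(* Defs.v *)
From HB Require Import structures.
From mathcomp Require Import all_boot all_order all_algebra.
From mathcomp Require Import all_classical all_reals all_analysis wochoice.
From mathcomp Require Import complex.

Set Implicit Arguments.
Unset Strict Implicit.
Unset Printing Implicit Defensive.

Import Order.TTheory GRing.Theory Num.Theory numFieldNormedType.Exports.

Local Open Scope classical_set_scope.
Local Open Scope ring_scope.

Variant scalar_kind := RealScalars | ComplexScalars.

Definition scalars (R : realType) (k : scalar_kind) : numFieldType :=
  match k with RealScalars => R | ComplexScalars => R[i] end.

Definition scalar_conj (R : realType) (k : scalar_kind) :
    scalars R k -> scalars R k :=
  match k with RealScalars => idfun | ComplexScalars => @Num.conj R[i] end.

(* The norm of a numFieldType takes its values in the field itself; [modulus]
   is the real-valued absolute value and [of_real] the inclusion of R. *)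
Definition modulus (R : realType) (k : scalar_kind) : scalars R k -> R :=
  match k with RealScalars => fun x => `|x| | ComplexScalars => @ComplexField.Normc.normc R end.

Definition of_real (R : realType) (k : scalar_kind) : R -> scalars R k :=
  match k with
  | RealScalars => idfun
  | ComplexScalars => fun r => r%:C%C
  end.

Section scalar_lemmas.
Variables (R : realType) (k : scalar_kind).

Lemma modulusE (x : scalars R k) : `|x| = of_real k (modulus x).
Proof. by case: k x. Qed.

Lemma modulus_ge0 (x : scalars R k) : 0 <= modulus x.
Proof. by case: k x => [x|[a b]] /=; [exact: normr_ge0|exact: sqrtr_ge0]. Qed.

Lemma le_of_real (r s : R) : (of_real k r <= of_real k s) = (r <= s).
Proof. by case: k => //=; rewrite lecR. Qed.

Lemma of_realD (r s : R) : of_real k (r + s) = of_real k r + of_real k s.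
Proof. by case: k => //=; rewrite rmorphD. Qed.

Lemma of_realM (r s : R) : of_real k (r * s) = of_real k r * of_real k s.
Proof. by case: k => //=; rewrite rmorphM. Qed.

Lemma of_real0 : of_real k (0 : R) = 0.
Proof. by case: k. Qed.

Lemma of_real1 : of_real k (1 : R) = 1.
Proof. by case: k. Qed.

Lemma of_real_inj : injective (@of_real R k).
Proof. by move=> r s e; apply/eqP; rewrite eq_le -!le_of_real e lexx. Qed.

Lemma le_modulusD (x y : scalars R k) : modulus (x + y) <= modulus x + modulus y.
Proof. by rewrite -le_of_real of_realD -!modulusE ler_normD. Qed.

Lemma modulusM (x y : scalars R k) : modulus (x * y) = modulus x * modulus y.
Proof. by apply: of_real_inj; rewrite of_realM -!modulusE normrM. Qed.

Lemma modulus0 : modulus (0 : scalars R k) = 0.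
Proof. by apply: of_real_inj; rewrite -modulusE normr0 of_real0. Qed.

Lemma modulus0_eq0 (x : scalars R k) : modulus x = 0 -> x = 0.
Proof. by move=> x0; apply/eqP; rewrite -normr_eq0 modulusE x0 of_real0. Qed.

End scalar_lemmas.

(* [omega1] is the set of points of a well-ordering of an uncountable set that
   have countably many predecessors. *)

Definition wo_le : rel (set nat) := sval (well_ordering_principle (set nat)).

Lemma wo_leP : well_order wo_le.
Proof. exact: (svalP (well_ordering_principle (set nat))). Qed.

Record omega1 := Omega1 {
  omega1_val : set nat ;
  _ : `[< countable [set y | wo_le y omega1_val] >] }.

HB.instance Definition _ := [isSub for omega1_val].
HB.instance Definition _ := [Choice of omega1 by <:].

Fact omega1_display : Order.disp_t. Proof. exact: Order.Disp tt tt. Qed.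

Section omega1_order.
Let le (a b : omega1) := wo_le (val a) (val b).

Lemma wo_le_chain : wo_chain wo_le predT.
Proof. by move=> A _; exact: wo_leP. Qed.

Lemma wo_le_refl : reflexive wo_le.
Proof. by move=> x; apply: (wo_chain_reflexive wo_le_chain). Qed.

Lemma wo_le_anti : antisymmetric wo_le.
Proof. by move=> x y; apply: (wo_chain_antisymmetric wo_le_chain). Qed.

Lemma wo_le_total : total wo_le.
Proof. by move=> x y; apply: (wo_chainW wo_le_chain). Qed.

Lemma wo_le_trans : transitive wo_le.
Proof.
move=> y x z xy yz.
have [|m [[mA mmin] _]] := @wo_leP (mem [:: x; y; z]).
  by exists x; rewrite !inE eqxx.
have mx : wo_le m x by apply: mmin; rewrite !inE eqxx.
have my : wo_le m y by apply: mmin; rewrite !inE eqxx ?orbT.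
have mz : wo_le m z by apply: mmin; rewrite !inE eqxx ?orbT.
move: mA; rewrite !inE => /or3P[] /eqP me; subst m => //.
- by have -> : x = y by apply: wo_le_anti; rewrite xy.
- have e : y = z by apply: wo_le_anti; rewrite yz.
  by rewrite -e.
Qed.

Let le_refl : reflexive le. Proof. by move=> a; exact: wo_le_refl. Qed.
Let le_anti : antisymmetric le.
Proof. by move=> a b ab; apply: val_inj; exact: wo_le_anti. Qed.
Let le_trans : transitive le. Proof. by move=> a b c; exact: wo_le_trans. Qed.

HB.instance Definition _ :=
  Order.Le_isPOrder.Build omega1_display omega1 le_refl le_anti le_trans.

Let le_total : total (<=%O : rel omega1).
Proof. by move=> a b; exact: wo_le_total. Qed.

HB.instance Definition _ :=
  Order.POrder_isTotal.Build omega1_display omega1 le_total.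

End omega1_order.

HB.instance Definition _ := OrderTopological.copy omega1 (order_topology omega1).

Lemma omega1_wf (A : set omega1) :
  A !=set0 -> exists2 a, A a & forall b, A b -> (a <= b)%O.
Proof.
move=> [a Aa].
have [|_ [[/asboolP[b Ab <-] bmin] _]] :=
    @wo_leP [pred x | `[< exists2 b, A b & val b = x >]].
  by exists (val a); apply/asboolP; exists a.
by exists b => // c Ac; apply: bmin; apply/asboolP; exists c.
Qed.

Lemma omega1_countable (a : omega1) : countable [set b | (b <= a)%O].
Proof.
have /asboolP/countable_injP[f finj] := valP a.
apply/countable_injP; exists (f \o val) => x y /set_mem xa /set_mem ya /= fxy.
by apply: val_inj; apply: finj => //; rewrite inE.
Qed.

Lemma set_nat_uncountable : ~ countable [set: set nat].
Proof.
move=> /countable_injP[f finj].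
pose D : set nat := [set n | exists2 x : set nat, f x = n & ~ x n].
have [Dd|nDd] := pselect (D (f D)); last by apply: (nDd); exists D.
have [x fx nx] := Dd; apply: nx.
by have -> // : x = D by apply: finj; rewrite ?inE.
Qed.

Lemma omega1_uncountable : ~ countable [set: omega1].
Proof.
move=> cW; have cV : countable [set val a | a in [set: omega1]].
  by apply: sub_countable cW; exact: card_image_le.
have [all_c|] := pselect (forall x, countable [set y | wo_le y x]).
  apply: set_nat_uncountable; apply: sub_countable cV; apply: subset_card_le.
  by move=> x _; exists (Omega1 (asboolT (all_c x))).
move/existsNP => [x0 nx0].
have [|x [[/asboolP nx xmin] _]] :=
    @wo_leP [pred x | `[< ~ countable [set y | wo_le y x] >]].
  by exists x0; apply/asboolP.
apply: nx; apply: (@sub_countable _ _ _ ([set x] `|` [set val a | a in [set: omega1]])).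
  apply: subset_card_le => y /= yx; have [->|/eqP yNx] := eqVneq y x; first by left.
  right; have [cy|ncy] := pselect (countable [set z | wo_le z y]).
    by exists (Omega1 (asboolT cy)).
  case: yNx; apply: wo_le_anti; rewrite yx /=; apply: xmin; exact/asboolP.
have -> : [set x] `|` [set val a | a in [set: omega1]] = \bigcup_(b : bool)
    (if b then [set x] else [set val a | a in [set: omega1]]).
  apply/seteqP; split => y.
    by move=> [yx|yW]; [exists true|exists false].
  by move=> [[] _ ?]; [left|right].
by apply: bigcup_countable => // -[].
Qed.

Lemma omega1_nonempty : [set: omega1] !=set0.
Proof.
apply/set0P/eqP => W0; apply: omega1_uncountable; rewrite W0.
exact: countable0.
Qed.

(* [0, omega_1]: the point omega_1 is None. *)
Definition omega1_top : Type := option omega1.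

HB.instance Definition _ := Choice.on omega1_top.

Section omega1_top_order.
Let le (a b : omega1_top) : bool :=
  match a, b with
  | _, None => true
  | None, Some _ => false
  | Some x, Some y => (x <= y)%O
  end.

Let le_refl : reflexive le. Proof. by case=> //= a. Qed.
Let le_anti : antisymmetric le.
Proof. by move=> [a|] [b|] //= ab; rewrite (le_anti ab). Qed.
Let le_trans : transitive le.
Proof. by move=> [b|] [a|] [c|] //=; exact: le_trans. Qed.

HB.instance Definition _ :=
  Order.Le_isPOrder.Build omega1_display omega1_top le_refl le_anti le_trans.

Let le_total : total (<=%O : rel omega1_top).
Proof. by move=> [a|] [b|] //; exact: (@le_total _ omega1). Qed.

HB.instance Definition _ :=
  Order.POrder_isTotal.Build omega1_display omega1_top le_total.

End omega1_top_order.

HB.instance Definition _ :=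
  OrderTopological.copy omega1_top (order_topology omega1_top).

(* The dual of a normed space: its linear continuous functionals, with the
   weak* topology, i.e. the topology of pointwise convergence. *)
Section weak_dual.
Variables (K : numFieldType) (E : normedModType K).

Definition functional : {pred E -> K^o} :=
  mem [set f : E -> K^o | linear f /\ continuous f].

Record weak_dual := WeakDual {
  weak_dual_fun :> E -> K^o ;
  _ : weak_dual_fun \in functional }.

HB.instance Definition _ := [isSub for weak_dual_fun].
HB.instance Definition _ := [Choice of weak_dual by <:].

Lemma functional_submod_closed : submod_closed functional.
Proof.
split=> [|a f g]; rewrite !inE /=.
  split=> [b x y|x]; first by rewrite /= scaler0 addr0.
  exact: cst_continuous.
move=> -[lf cf] [lg cg]; split=> [b x y|x].
  rewrite !fctE lf lg !scalerDr -!addrA; congr (_ + _).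
    by rewrite !scalerA mulrC.
  by rewrite addrCA.
by apply: cvgD; [apply: cvgZl_tmp; exact: cf|exact: cg].
Qed.

HB.instance Definition _ :=
  GRing.isSubmodClosed.Build _ _ functional functional_submod_closed.
HB.instance Definition _ := [SubChoice_isSubLmodule of weak_dual by <:].

HB.instance Definition _ := Topological.copy weak_dual
  (initial_topology (weak_dual_fun : weak_dual -> {ptws E -> K^o})).

End weak_dual.

(* A normed space with the weak topology, i.e. the initial topology for all
   its linear continuous functionals. *)
Section weak_space.
Variables (K : numFieldType) (E : normedModType K).

Definition weak_space : Type := E.

HB.instance Definition _ := Choice.on weak_space.

Definition weak_eval (x : weak_space) : {ptws weak_dual E -> K^o} :=
  fun f => f (x : E).

HB.instance Definition _ :=
  Topological.copy weak_space (initial_topology weak_eval).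

End weak_space.

(* C_0[0, omega_1): on [0, omega_1) a continuous function vanishes at infinity
   exactly when it vanishes eventually. *)
Section C0.
Variables (R : realType) (k : scalar_kind).
Local Notation K := (scalars R k).

Definition C0_fun : {pred omega1 -> K^o} :=
  mem [set f : omega1 -> K^o | continuous f /\
    exists b : omega1, forall a, (b <= a)%O -> f a = 0].

Record C0 := MkC0 {
  C0_val :> omega1 -> K^o ;
  _ : C0_val \in C0_fun }.

HB.instance Definition _ := [isSub for C0_val].
HB.instance Definition _ := [Choice of C0 by <:].

Lemma C0_submod_closed : submod_closed C0_fun.
Proof.
split=> [|a f g]; rewrite !inE /=.
  split; first exact: cst_continuous.
  by have [b _] := omega1_nonempty; exists b.
move=> -[cf [b fb]] [cg [c gc]]; split=> [x|].
  by apply: (@continuousD K K^o _ (a *: f) g); [apply: (@continuousZl_tmp K K^o _ f a); exact: cf|exact: cg].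
exists (Order.max b c) => d; rewrite ge_max => /andP[bd cd].
by rewrite !fctE fb // gc // scaler0 addr0.
Qed.

HB.instance Definition _ :=
  GRing.isSubmodClosed.Build _ _ C0_fun C0_submod_closed.
HB.instance Definition _ := [SubChoice_isSubLmodule of C0 by <:].

Definition sup_norm (f : C0) : R := sup [set modulus (f a) | a in [set: omega1]].

Lemma C0_bounded (f : C0) :
  exists M, forall a, modulus (f a) <= M.
Proof.
have /set_mem [cf [c fc]] := valP f.
suff H a : exists M, forall b, (b <= a)%O -> modulus (f b) <= M.
  have [M fM] := H c; exists (Num.max M 0) => a.
  have [ac|/ltW ca] := leP a c; first by rewrite le_max fM.
  by rewrite [f a]fc // modulus0 le_max lexx orbT.
apply: contrapT => na.
pose A := [set a | ~ exists M, forall b, (b <= a)%O -> modulus (f b) <= M].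
have [|{na}a Aa amin] := @omega1_wf A; first by exists a.
have : nbhs a [set x | modulus (f x) <= modulus (f a) + 1].
  have /cvgrPdist_le/(_ 1 ltr01) := cf a.
  apply: filterS => x /= fx.
  rewrite -(subrK (f a) (f x)) addrC (le_trans (le_modulusD _ _)) // lerD2l.
  by rewrite -(le_of_real k) of_real1 -modulusE distrC.
rewrite itv_nbhsE => -[[l r] /= [lr ia] lrf].
apply: Aa.
have [[b ba bl]|nb] := pselect (exists2 b, (b < a)%O &
    forall x, (x <= a)%O -> x \notin Interval l r -> (x <= b)%O).
  have [M bM] : exists M, forall x, (x <= b)%O -> modulus (f x) <= M.
    by apply: contrapT => /amin; rewrite leNgt ba.
  exists (Num.max M (modulus (f a) + 1)) => x xa; rewrite le_max.
  have [xi|/(bl _ xa) xb] := boolP (x \in Interval l r).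
    by rewrite (lrf _ xi) orbT.
  by rewrite bM.
exists (modulus (f a) + 1) => x xa; apply: lrf => /=.
rewrite itv_boundlr; move: (ia); rewrite itv_boundlr => /andP[la ar].
rewrite (le_trans _ ar) ?bnd_simp // andbT.
case: l la ia lr nb => [[] y|[]] //; rewrite !bnd_simp.
move=> ya ia _ nb; exfalso; apply: nb; exists y => // z za.
apply: contraNT; rewrite -ltNge => yz.
by rewrite itv_boundlr bnd_simp yz (le_trans _ ar) ?bnd_simp.
Qed.

Lemma C0_has_sup (f : C0) : has_sup [set modulus (f a) | a in [set: omega1]].
Proof.
have [a0 _] := omega1_nonempty; split; first by exists (modulus (f a0)), a0.
by have [M fM] := C0_bounded f; exists M => _ [a _ <-].
Qed.

Lemma le_sup_norm (f : C0) a : modulus (f a) <= sup_norm f.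
Proof. by apply: ub_le_sup; [case: (C0_has_sup f)|exists a]. Qed.

Lemma sup_norm_le (f : C0) M : (forall a, modulus (f a) <= M) -> sup_norm f <= M.
Proof. by move=> fM; apply: ge_sup => [|_ [a _ <-]//]; case: (C0_has_sup f). Qed.

Lemma sup_norm_ge0 (f : C0) : 0 <= sup_norm f.
Proof.
have [a0 _] := omega1_nonempty.
exact: le_trans (modulus_ge0 _) (le_sup_norm f a0).
Qed.

Lemma sup_normD (f g : C0) :
  of_real k (sup_norm (f + g)) <= of_real k (sup_norm f) + of_real k (sup_norm g).
Proof.
rewrite -of_realD le_of_real; apply: sup_norm_le => a.
by rewrite (le_trans (le_modulusD _ _)) // lerD // le_sup_norm.
Qed.

Lemma sup_normZ (c : K) (f : C0) :
  of_real k (sup_norm (c *: f)) = `|c| * of_real k (sup_norm f).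
Proof.
rewrite modulusE -of_realM; congr (of_real k _); apply/eqP.
rewrite eq_le; apply/andP; split.
  apply: sup_norm_le => a; rewrite [X in modulus X]/= modulusM.
  by rewrite ler_wpM2l ?modulus_ge0 ?le_sup_norm.
have [->|c0] := eqVneq c 0; first by rewrite modulus0 mul0r sup_norm_ge0.
have mc : 0 < modulus c.
  rewrite lt_def modulus_ge0 andbT; apply: contra_neq c0; exact: modulus0_eq0.
rewrite -ler_pdivlMl //; apply: sup_norm_le => a.
by rewrite ler_pdivlMl // -modulusM; exact: (le_sup_norm (c *: f)).
Qed.

Lemma sup_norm0_eq0 (f : C0) : of_real k (sup_norm f) = 0 -> f = 0.
Proof.
rewrite -(of_real0 R k) => /of_real_inj f0; apply: val_inj; apply/funext => a.
apply: modulus0_eq0; apply/eqP; rewrite eq_le modulus_ge0 andbT -f0.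
exact: le_sup_norm.
Qed.

HB.instance Definition _ :=
  Lmodule_isNormed.Build K C0 sup_normD sup_normZ sup_norm0_eq0.

Lemma C0_normE (f : C0) : `|f| = of_real k (sup_norm f). Proof. by []. Qed.

Definition eval_at (a : omega1) (f : C0) : K^o := f a.

Lemma eval_at_functional (a : omega1) : eval_at a \in @functional K C0.
Proof.
have lin : linear (eval_at a) by [].
pose L := HB.pack (eval_at a) (GRing.isLinear.Build K C0 K^o _ (eval_at a) lin)
  : {linear C0 -> K^o}.
rewrite inE /=; split=> //; apply: (@bounded_linear_continuous _ _ _ L).
apply/linear_boundedP; near=> r => f.
have r1 : 1 <= r by near: r; exact: nbhs_pinfty_ge.
rewrite (@le_trans _ _ `|f|) //; last by rewrite ler_peMl.
by rewrite C0_normE [X in X <= _]modulusE le_of_real le_sup_norm.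
Unshelve. all: by end_near. Qed.

Definition delta (a : omega1) : weak_dual C0 := WeakDual (eval_at_functional a).

End C0.

Definition homeomorphic (X Y : topologicalType) : Prop :=
  exists (f : X -> Y) (g : Y -> X),
    [/\ cancel f g, cancel g f, continuous f & continuous g].

(* The first condition says that H is a Hilbert space: its complete norm comes
   from the inner product [dot]. *)
Definition uniformly_eberlein_compact (R : realType) (k : scalar_kind)
    (X : topologicalType) : Prop :=
  exists (H : completeNormedModType (scalars R k))
         (dot : {dot H for @scalar_conj R k}) (A : set (weak_space H)),
    [/\ forall x : H, `|x| ^+ 2 = dot x x, compact A & homeomorphic X A].

Definition club (D : set omega1) : Prop := closed D /\ ~ has_ubound D.

Definition delta_copy (R : realType) (k : scalar_kind) (rho : weak_dual (C0 R k))
    (lambda : scalars R k) (D : set omega1) : set (weak_dual (C0 R k)) :=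
  [set rho + lambda *: delta R k a | a in D] `|` [set rho].

Definition contains_delta_copy (R : realType) (k : scalar_kind)
    (K : set (weak_dual (C0 R k))) : Prop :=
  exists (rho : weak_dual (C0 R k)) (lambda : scalars R k) (D : set omega1),
    [/\ lambda != 0, club D, delta_copy rho lambda D `<=` K &
        homeomorphic omega1_top (delta_copy rho lambda D)].

(* Main.v *)
(* A functional [mu] on C_0[0, omega_1) is determined by its values on the
   steps [1_[0, a]], that is by the function [F a = mu [0, a]], which has bounded
   variation; let [t] be its eventual value. Let [A] be weak* compact, hence
   norm bounded.

   Either there are [e > 0] and [b] such that for every [a] some [mu] in [A] has
   [|t - F c| >= e] for all [c] in [b, a). Take a cluster point [(rho, s)] of the
   corresponding pairs [(mu, t)] as [a] tends to omega_1 and put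
   [lambda = s - rho [0, omega_1)]. A closing-off argument gives a club [D] such
   that for [a] in [D] the functional [rho + lambda delta_a] is a weak* limit of
   those [mu] whose [F] has become constant before [a]: this is (II).

   Or closing off gives a club [D] such that [mu [d, omega_1) = 0] for all [d] in
   [D] and [mu] in [A]. Then [mu] is determined by its restrictions to the
   countable blocks between consecutive elements of [D]; testing each block
   against countably many steps with summable weights embeds [A] into a bounded
   subset of l_2(omega_1), continuously for the weak topology: this is (I).

   The alternatives exclude each other because [0, omega_1] has no embedding [h]
   into a Hilbert space with its weak topology: put [x_a = h a - h omega_1]. Each
   [<x_b, x_a>] vanishes for large [b], so there is an increasing sequence [a_n]
   with supremum [s] such that every [x_(a_n)] is orthogonal to [x_s]; then
   [<x_s, x_s> = 0], although [x_s] is not [0]. *)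

From HB Require Import structures.
Require Import Defs.
From mathcomp Require Import all_boot all_order all_algebra.
From mathcomp Require Import all_classical all_reals all_analysis.
From mathcomp Require Import finmap complex ring lra.
Import Order.TTheory GRing.Theory Num.Theory numFieldNormedType.Exports.
Set Implicit Arguments.
Unset Strict Implicit.
Unset Printing Implicit Defensive.
Local Open Scope classical_set_scope.
Local Open Scope ring_scope.

(** * Clubs in omega_1 *)

Section well_ordered_topology.
Local Open Scope order_scope.
Context {d} {T : orderTopologicalType d}.
Hypothesis wfT : forall A : set T,
  A !=set0 -> exists2 a, A a & forall b, A b -> a <= b.

(** Unless [a] is the maximum, well-foundedness gives a least point [s] above [a], and the points up
    to [a] are exactly those below [s]. *)
Lemma wf_open_le (a : T) : open [set b : T | b <= a].
Proof.
have [[c ac]|/forallNP na] := pselect (exists c, a < c); last first.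
  suff -> : [set b : T | b <= a] = setT by exact: openT.
  by apply/seteqP; split => // b _ /=; rewrite leNgt; apply/negP => /na.
have [|s /= as_ smin] := @wfT [set c | a < c]; first by exists c.
have -> : [set b : T | b <= a] = [set` `]-oo, s[].
  apply/seteqP; split => b /=; rewrite in_itv /=; first by move=> /le_lt_trans; apply.
  by move=> bs; rewrite leNgt; apply/negP => /smin; rewrite leNgt bs.
exact: lray_open.
Qed.

Lemma wf_open_lt (a : T) : open [set b : T | a < b].
Proof.
have -> : [set b : T | a < b] = [set` `]a, +oo[].
  by apply/seteqP; split => b /=; rewrite in_itv /= andbT.
exact: rray_open.
Qed.

(** Since the points up to [a] form an open set, only the intervals ]b, a] matter near [a]. The
    least point admits no such interval and is isolated, whence the guard on the existence of some
    [b < a]. *)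
Lemma wf_nbhsP (a : T) (U : set T) : nbhs a U <->
  U a /\ ((exists b, b < a) -> exists2 b, b < a & forall c, b < c -> c <= a -> U c).
Proof.
split.
  move=> Ua; split; first exact: nbhs_singleton.
  move=> [z za]; move: Ua; rewrite itv_nbhsE => -[[l r] /= [lr ia] lrU].
  move: (ia); rewrite itv_boundlr => /andP[la ar].
  case: l la ia lr lrU => [[] y|[]] // la ia lr lrU.
    by exists y => // c yc ca; apply: lrU => /=; rewrite itv_boundlr bnd_simp yc (le_trans _ ar) // bnd_simp.
  by exists z => // c zc ca; apply: lrU => /=; rewrite itv_boundlr bnd_simp (le_trans _ ar) // bnd_simp.
move=> [Ua Ub].
have [ex|/forallNP na] := pselect (exists b, b < a).
  have [b ba bU] := Ub ex.
  have : nbhs a ([set c | b < c] `&` [set c | c <= a]).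
    apply: open_nbhs_nbhs; split; last by split => /=.
    by apply: openI; [exact: wf_open_lt|exact: wf_open_le].
  by apply: filterS => c [] /=; exact: bU.
have : nbhs a [set b : T | b <= a].
  by apply: open_nbhs_nbhs; split => /=; [exact: wf_open_le|].
by apply: filterS => b /=; rewrite le_eqVlt => /orP[/eqP->//|/na].
Qed.

End well_ordered_topology.

Definition omega1_nbhsP := @wf_nbhsP _ omega1 omega1_wf.

Lemma omega1_top_wf (A : set omega1_top) :
  A !=set0 -> exists2 a, A a & forall b, A b -> (a <= b)%O.
Proof.
move=> A0; have [[a Aa]|/forallNP n] := pselect (exists a, A (Some a)).
  have [|b Ab bmin] := @omega1_wf [set a | A (Some a)]; first by exists a.
  by exists (Some b) => // -[c|] //; exact: bmin.
by case: A0 => -[a|] Aa; [case: (n a)|exists None => // -[b|] // /n].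
Qed.

Definition omega1_top_nbhsP := @wf_nbhsP _ omega1_top omega1_top_wf.

(** * Countable suprema, closing off and enumeration of clubs *)

Section omega1_countable_sets.
Local Open Scope order_scope.

(** Otherwise the countable initial segments up to the points of [A] would cover omega_1. *)
Lemma omega1_countable_ubound (A : set omega1) :
  countable A -> exists b, forall a, A a -> a <= b.
Proof.
move=> cA; apply: contrapT => /forallNP nb.
apply: omega1_uncountable.
apply: (@sub_countable _ _ _ (\bigcup_(a in A) [set b | b <= a])).
  apply: subset_card_le => b _.
  have /existsNP[a /not_implyP[Aa /negP]] := nb b.
  by rewrite -ltNge => /ltW ba; exists a.
by apply: bigcup_countable => // a _; exact: omega1_countable.
Qed.

Lemma omega1_gt (a : omega1) : exists b, a < b.
Proof.
apply: contrapT => /forallNP n; apply: omega1_uncountable.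
apply: sub_countable (omega1_countable a); apply: subset_card_le => b _ /=.
by rewrite leNgt; apply/negP => /n.
Qed.

Lemma omega1_seq_ubound (u : nat -> omega1) : exists b, forall n, u n <= b.
Proof.
have [|b bP] := @omega1_countable_ubound (range u).
  exact: sub_countable (card_image_le _ _) (countableP _).
by exists b => n; apply: bP; exists n.
Qed.

Lemma omega1_ind (P : omega1 -> Prop) :
  (forall a, (forall b, b < a -> P b) -> P a) -> forall a, P a.
Proof.
move=> H a; apply: contrapT => na.
have [|b nb bmin] := @omega1_wf [set b | ~ P b]; first by exists a.
by apply: nb; apply: H => c cb; apply: contrapT => /bmin; rewrite leNgt cb.
Qed.

Lemma omega1_lt_wf : well_founded (fun a b : omega1 => a < b).
Proof. by move=> a; elim/omega1_ind: a => a IH; constructor. Qed.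

Lemma omega1_seq_sup (u : nat -> omega1) : (forall n, u n < u n.+1) ->
  exists b, (forall n, u n < b) /\ forall c, c < b -> exists n, c < u n.
Proof.
move=> uS; have [b0 b0P] := omega1_seq_ubound u.
have [|b bub bmin] := @omega1_wf [set b | forall n, u n <= b]; first by exists b0.
exists b; split=> [n|c cb]; first exact: lt_le_trans (uS n) (bub n.+1).
apply: contrapT => /forallNP nc; move: cb; rewrite ltNge => /negP; apply.
by apply: bmin => n; rewrite leNgt; apply/negP => /nc.
Qed.

(** Unboundedness: as initial segments are countable, some [g] satisfies [Phi b < g x] for all
    [b <= x], and the supremum of the iterates of [g] is closed under [Phi]. *)
Lemma closing_club (Phi : omega1 -> omega1) (z : omega1) :
  club [set a | z < a /\ forall b, b < a -> Phi b < a].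
Proof.
split.
  move=> a aD.
  have [za|az] := ltP z a; last first.
    have az' : nbhs a [set b | b <= z].
      have : nbhs a [set b : omega1 | b <= a].
        by apply: open_nbhs_nbhs; split => /=; [exact: (wf_open_le omega1_wf)|].
      by apply: filterS => b /= /le_trans; apply.
    by have [b [[zb _] /= bz]] := aD _ az'; move: zb; rewrite ltNge bz.
  split=> // b ba.
  have Ub : nbhs a ([set c | b < c] `&` [set c | c <= a]).
    apply: open_nbhs_nbhs; split; last by split => /=.
    by apply: openI; [exact: wf_open_lt|exact: (wf_open_le omega1_wf)].
  by have [c [[_ cP] [/= bc ca]]] := aD _ Ub; exact: lt_le_trans (cP _ bc) ca.
move=> [a ub].
have nxt (x : omega1) : exists y, [/\ x < y, z < y & forall b, b <= x -> Phi b < y].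
  have [|y yP] := @omega1_countable_ubound (Phi @` [set b | b <= x]).
    by apply: sub_countable (omega1_countable x); exact: card_image_le.
  have [y'] := omega1_gt (Order.max y (Order.max x z)).
  rewrite !gt_max => /and3P[yy' xy' zy']; exists y'; split => // b bx.
  by apply: le_lt_trans yy'; apply: yP; exists b.
have [g gP] := choice nxt.
pose u n := iter n g a.
have [s [us sP]] : exists b, (forall n, u n < b) /\ forall c, c < b -> exists n, c < u n.
  by apply: omega1_seq_sup => n; have [] := gP (u n).
suff /ub : [set a | z < a /\ forall b, b < a -> Phi b < a] s by rewrite leNgt (us 0%N).
split=> [|b /sP[n /ltW bn]]; first by have [_ zu _] := gP (u 0%N); exact: lt_trans zu (us 1%N).
by have [_ _ /(_ _ bn) h] := gP (u n); exact: lt_trans h (us n.+1).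
Qed.

Lemma club_next (D : set omega1) (a : omega1) : club D ->
  exists2 d, D d /\ a < d & forall c, D c -> a < c -> d <= c.
Proof.
move=> [_ nD]; have [|d [Dd ad] dmin] := @omega1_wf [set d | D d /\ a < d].
  apply: contrapT => /forallNP n; apply: nD; exists a => d Dd.
  by rewrite leNgt; apply/negP => ad; apply: (n d).
by exists d => // c Dc ac; exact: dmin.
Qed.

(* Transfinite recursion: [e a] is the least element of [D] above all [e b], [b < a]. *)
Lemma club_enumeration (D : set omega1) : club D -> exists e : omega1 -> omega1,
  [/\ forall a b, a < b -> e a < e b, forall a, a <= e a,
      forall a, D (e a), forall d, D d -> exists a, e a = d & continuous e].
Proof.
move=> cD; have [clD nD] := cD; have [w0 _] := omega1_nonempty.
pose minD (A : set omega1) := xget w0 [set d | A d /\ forall c, A c -> d <= c].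
have minDP (A : set omega1) : A !=set0 -> A (minD A) /\ forall c, A c -> minD A <= c.
  by move=> /omega1_wf[a Aa amin]; rewrite /minD; case: xgetP => [x -> //|/(_ a)]; case.
pose step (a : omega1) (r : forall b, b < a -> omega1) :=
  minD [set d | D d /\ forall b (ba : b < a), r b ba < d].
pose e := Fix omega1_lt_wf (fun=> omega1) step.
have eE a : e a = minD [set d | D d /\ forall b, b < a -> e b < d].
  rewrite /e Fix_eq // => x f g fg; congr minD; apply/seteqP.
  by split=> d [Dd H]; split=> // b bx; [rewrite -fg|rewrite fg].
have ne a : [set d | D d /\ forall b, b < a -> e b < d] !=set0.
  have [|u uP] := @omega1_countable_ubound (e @` [set b | b <= a]).
    by apply: sub_countable (omega1_countable a); exact: card_image_le.
  have [d [Dd ud] _] := @club_next D u cD; exists d; split=> // b /ltW ba.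
  by apply: le_lt_trans ud; apply: uP; exists b.
have eP a : [/\ D (e a), forall b, b < a -> e b < e a &
    forall c, D c -> (forall b, b < a -> e b < c) -> e a <= c].
  have [[H0 H1] H2] := minDP _ (ne a); rewrite -eE in H0 H1 H2.
  by split=> // c Dc H; apply: H2.
have einc a b : a < b -> e a < e b by move=> ab; have [_ H _] := eP b; exact: H.
have ege a : a <= e a.
  elim/omega1_ind: a => a IH; rewrite leNgt; apply/negP => ea.
  by have := einc _ _ ea; rewrite ltNge IH.
have eD a : D (e a) by have [] := eP a.
exists e; split => // [d Dd|a].
  have [|a /= da amin] := @omega1_wf [set a | d <= e a]; first by exists d; exact: ege.
  exists a; apply/eqP; rewrite eq_le da andbT; have [_ _ H] := eP a; apply: H => // b ba.
  by rewrite ltNge; apply/negP => /amin; rewrite leNgt ba.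
move=> U /omega1_nbhsP[Uea Ub]; apply/omega1_nbhsP; split=> // -[z za].
have [b ba bU] : exists2 b, b < e a & forall c, b < c -> c <= e a -> U c.
  by apply: Ub; exists (e z); exact: einc.
have eale c : c <= a -> e c <= e a by rewrite le_eqVlt => /orP[/eqP->|/einc/ltW].
(* If all [e c] with [c < a] stay below [b], then either [a] is a successor, hence isolated, or the
   supremum [s] of these values lies in the closed set [D], and [e a <= s <= b] contradicts
   [b < e a]. *)
have [[c ca bc]|n] := pselect (exists2 c, c < a & b <= e c).
  exists c => // x cx xa; apply: bU; last exact: eale.
  by apply: le_lt_trans bc _; exact: einc.
have eb c : c < a -> e c < b.
  by move=> ca; rewrite ltNge; apply/negP => bc; apply: n; exists c.
have [|s /= sub smin] := @omega1_wf [set s | forall c, c < a -> e c <= s].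
  by exists b => c /eb /ltW.
have sb : s <= b by apply: smin => c /eb /ltW.
have [[t ta tmax]|nt] := pselect (exists2 t, t < a & forall c, c < a -> c <= t).
  exists t => // x tx; rewrite le_eqVlt => /orP[/eqP-> //|/tmax].
  by rewrite leNgt tx.
have Ds : D s.
  apply: clD => V /omega1_nbhsP[Vs Vb].
  have [c ca cs] : exists2 c, c < a & forall w, e c <= w -> w <= s -> V w.
    have [|w ws wV] := Vb.
      exists (e z); have [z' z'a zz'] : exists2 z', z' < a & z < z'.
        apply: contrapT => nz; apply: nt; exists z => // c ca; rewrite leNgt.
        by apply/negP => zc; apply: nz; exists c.
      by apply: lt_le_trans (einc _ _ zz') _; exact: sub.
    have [c ca wc] : exists2 c, c < a & w < e c.
      apply: contrapT => nw; move: ws; rewrite ltNge => /negP; apply; apply: smin.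
      by move=> c ca; rewrite leNgt; apply/negP => wc; apply: nw; exists c.
    by exists c => // x cx; apply: wV; exact: lt_le_trans cx.
  by exists (e c); split; [exact: eD|apply: cs => //; exact: sub].
suff : e a <= s by rewrite leNgt (le_lt_trans sb ba).
have [_ _ H] := eP a; apply: H => // c ca.
have [c' c'a cc'] : exists2 c', c' < a & c < c'.
  apply: contrapT => nz; apply: nt; exists c => // x xa; rewrite leNgt.
  by apply/negP => cx; apply: nz; exists x.
by apply: lt_le_trans (einc _ _ cc') _; exact: sub.
Qed.

End omega1_countable_sets.

(** * Scalars *)

Lemma ultra_fmap (T S : Type) (U : set_system T) (g : T -> S) :
  UltraFilter U -> UltraFilter (g @ U).
Proof.
move=> UU; split; first exact: fmap_proper_filter.
move=> G PG UG; apply/seteqP; split=> // A GA.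
have [//|UnA] := in_ultra_setVsetC (g @^-1` A) UU.
have /UG GnA : (g @ U) (~` A) by [].
have GAA : G (A `&` ~` A) by apply: filterI.
by have [y []] := @filter_ex _ G PG _ GAA.
Qed.

Section scalars_theory.
Variables (R : realType) (k : scalar_kind).
Local Notation K := (scalars R k).
Local Notation conj := (@scalar_conj R k).

Lemma scalar_conjD : {morph conj : x y / x + y}.
Proof. by case: k => x y //=; rewrite rmorphD. Qed.

Lemma scalar_conjM : {morph conj : x y / x * y}.
Proof. by case: k => x y //=; rewrite rmorphM. Qed.

Lemma scalar_conjK : involutive conj.
Proof. by case: k => x //=; rewrite conjCK. Qed.

Lemma scalar_conj0 : conj 0 = 0.
Proof. by case: k => //=; rewrite rmorph0. Qed.

Lemma scalar_conjB : {morph conj : x y / x - y}.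
Proof. by case: k => x y //=; rewrite rmorphB. Qed.

Lemma scalar_mul_conj (x : K) : x * conj x = of_real k (modulus x ^+ 2).
Proof.
rewrite expr2 of_realM -modulusE -expr2.
by case: k x => x /=; [rewrite real_normK ?num_real ?expr2|rewrite sqr_normc].
Qed.

Lemma modulus_conj (x : K) : modulus (conj x) = modulus x.
Proof.
apply: (@of_real_inj R k); rewrite -!modulusE.
by case: k x => x //=; rewrite normcJ.
Qed.

Lemma modulus_of_real (r : R) : modulus (of_real k r) = `|r|.
Proof.
apply: (@of_real_inj R k); rewrite -modulusE.
by case: k => //=; rewrite normc_def /= expr0n addr0 sqrtr_sqr.
Qed.

Lemma scalar_conj_of_real (r : R) : conj (of_real k r) = of_real k r.
Proof. by case: k => //=; apply/CrealP; rewrite complex_real. Qed.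

Lemma modulusN (x : K) : modulus (- x) = modulus x.
Proof. by apply: (@of_real_inj R k); rewrite -!modulusE normrN. Qed.

Lemma modulusBC (x y : K) : modulus (x - y) = modulus (y - x).
Proof. by rewrite -opprB modulusN. Qed.

Lemma modulus1 : modulus (1 : K) = 1.
Proof. by apply: (@of_real_inj R k); rewrite -!modulusE normr1 of_real1. Qed.

Lemma of_realN (r : R) : of_real k (- r) = - of_real k r.
Proof. by case: k => //=; rewrite rmorphN. Qed.

Lemma of_realV (r : R) : of_real k (r^-1) = (of_real k r)^-1.
Proof. by case: k => //=; rewrite fmorphV. Qed.

Lemma lt_of_real (r s : R) : (of_real k r < of_real k s) = (r < s).
Proof. by rewrite !lt_def le_of_real (inj_eq (@of_real_inj R k)). Qed.

Lemma le_modulusB (x y z : K) : modulus (x - z) <= modulus (x - y) + modulus (y - z).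
Proof. by rewrite -(subrKA y) le_modulusD. Qed.

Lemma le_modulus_sub (x y : K) : modulus x <= modulus y + modulus (x - y).
Proof. by rewrite -{1}(subrK y x) addrC le_modulusD. Qed.

Lemma modulus_gt0 (x : K) : (0 < modulus x) = (x != 0).
Proof.
rewrite lt_def modulus_ge0 andbT; congr (~~ _); apply/eqP/eqP => [|->].
  exact: modulus0_eq0.
exact: modulus0.
Qed.

Lemma modulus_sum (I : Type) (s : seq I) (P : pred I) (F : I -> K) :
  modulus (\sum_(i <- s | P i) F i) <= \sum_(i <- s | P i) modulus (F i).
Proof.
elim/big_rec2: _ => [|i y x _ xy]; first by rewrite modulus0.
by rewrite (le_trans (le_modulusD _ _)) // lerD2l.
Qed.

Lemma of_real_sum (I : Type) (s : seq I) (P : pred I) (F : I -> R) :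
  of_real k (\sum_(i <- s | P i) F i) = \sum_(i <- s | P i) of_real k (F i).
Proof. by case: k => //=; rewrite rmorph_sum. Qed.

(** [c] is the conjugate phase of [x], or 0 when [x = 0]. Such factors turn a sum of values of a
    functional into a sum of moduli. *)
Lemma scalar_signP (x : K) : exists c : K, modulus c <= 1 /\ c * x = of_real k (modulus x).
Proof.
have [->|x0] := eqVneq x 0.
  by exists 0; rewrite modulus0 ler01 mulr0 of_real0.
have m0 : modulus x != 0 by rewrite gt_eqF // modulus_gt0.
exists (of_real k (modulus x)^-1 * conj x); split.
  rewrite modulusM modulus_of_real modulus_conj ger0_norm ?invr_ge0 ?modulus_ge0 //.
  by rewrite mulVf.
rewrite -mulrA [conj x * x]mulrC scalar_mul_conj -of_realM.
by rewrite expr2 mulKf.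
Qed.

Lemma gt0_of_real (e : K) : 0 < e -> exists2 r : R, 0 < r & e = of_real k r.
Proof.
move=> e0; exists (modulus e); first by rewrite modulus_gt0 gt_eqF.
by rewrite -modulusE gtr0_norm.
Qed.

Lemma cvg_modulusP (T : Type) (F : set_system T) {FF : Filter F}
    (f : T -> K^o) (l : K^o) :
  f @ F --> l <-> forall e : R, 0 < e -> \forall x \near F, modulus (f x - l) < e.
Proof.
split=> [/cvgrPdist_lt fl e e0|fl].
  have := fl (of_real k e); rewrite -{1}(of_real0 R k) lt_of_real => /(_ e0).
  by apply: filterS => x; rewrite modulusE lt_of_real modulusBC.
apply/cvgrPdist_lt => _ /gt0_of_real[e e0 ->]; apply: filterS (fl e e0) => x.
by rewrite modulusE lt_of_real modulusBC.
Qed.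

(** Compactness of [-C, C], applied to real and imaginary parts in the complex case. Limits of
    bounded families are extracted along ultrafilters by this fact. *)
Lemma bounded_ultra_cvg (T : Type) (U : set_system T) {UU : UltraFilter U}
    (f : T -> K^o) (C : R) :
  (\forall x \near U, modulus (f x) <= C) -> exists l : K^o, f @ U --> l.
Proof.
have Rcvg (g : T -> R) : (\forall x \near U, `|g x| <= C) ->
    exists l : R, forall e, 0 < e -> \forall x \near U, `|g x - l| < e.
  move=> gC; have := @segment_compact R (- C) C; rewrite compact_ultra => /(_ (g @ U)).
  case=> [||l [_ /= gl]].
  - exact: ultra_fmap.
  - by rewrite /fmap /=; apply: filterS gC => x /=; rewrite in_itv /= -ler_norml.
  - exists l => e e0; have /cvgrPdist_lt/(_ e e0) := gl.
    by apply: filterS => x; rewrite distrC.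
case: k f => f fC.
  by have [l lP] := Rcvg f fC; exists l; apply/cvgrPdist_lt => e /lP; apply: filterS => x; rewrite distrC.
have mRe (z : R[i]) : `|complex.Re z| <= ComplexField.Normc.normc z.
  by case: z => a b /=; rewrite -[leLHS]sqrtr_sqr ler_sqrt ?lerDl ?sqr_ge0 // addr_ge0 ?sqr_ge0.
have mIm (z : R[i]) : `|complex.Im z| <= ComplexField.Normc.normc z.
  by case: z => a b /=; rewrite -[leLHS]sqrtr_sqr ler_sqrt ?lerDr ?sqr_ge0 // addr_ge0 ?sqr_ge0.
have [|a aP] := Rcvg (fun x => complex.Re (f x)).
  by apply: filterS fC => x; exact: le_trans.
have [|b bP] := Rcvg (fun x => complex.Im (f x)).
  by apply: filterS fC => x; exact: le_trans.
exists (a +i* b)%C; apply/cvgrPdist_lt => e e0.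
have -> : e = ((complex.Re e)%:C)%C by apply/eqP; rewrite eq_complex /= eqxx /=; move: e0; rewrite ltcE => /andP[].
have e1 : 0 < complex.Re e by move: e0; rewrite ltcE => /andP[].
have e2 : 0 < complex.Re e / 2 by rewrite divr_gt0.
near=> x; rewrite normc_def ltcR /=.
have ha : `|complex.Re (f x) - a| < complex.Re e / 2 by near: x; exact: aP.
have hb : `|complex.Im (f x) - b| < complex.Re e / 2 by near: x; exact: bP.
case: (f x) ha hb => u v /= ha hb.
rewrite -[ltRHS]gtr0_norm // -sqrtr_sqr ltr_sqrt ?exprn_gt0 //.
rewrite -(real_normK (num_real (a - u))) -(real_normK (num_real (b - v))).
rewrite (distrC a) (distrC b).
have na := normr_ge0 (u - a); have nb := normr_ge0 (v - b).
nra.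
Unshelve. all: by end_near. Qed.

Lemma cvg_modulus_le (T : Type) (F : set_system T) {FF : ProperFilter F}
    (f : T -> K^o) (l m : K^o) (C : R) :
  f @ F --> l -> (\forall x \near F, modulus (f x - m) <= C) -> modulus (l - m) <= C.
Proof.
move=> /cvg_modulusP fl fC; apply/ler_addgt0Pr => e e0.
have [x [xl xC]] := @filter_ex _ F FF _ (filterI (fl e e0) fC).
by rewrite (le_trans (le_modulusB l (f x) m)) // modulusBC addrC lerD // ltW.
Qed.

Lemma cvg_scalar_unique (T : Type) (F : set_system T) {FF : ProperFilter F}
    (f : T -> K^o) (l m : K^o) : f @ F --> l -> f @ F --> m -> l = m.
Proof.
move=> fl /cvg_modulusP fm; apply/eqP; rewrite -subr_eq0; apply/eqP.
apply: modulus0_eq0; apply/eqP; rewrite eq_le modulus_ge0 andbT.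
apply/ler_addgt0Pr => e e0; rewrite add0r.
by apply: cvg_modulus_le fl _; apply: filterS (fm e e0) => x /ltW.
Qed.

End scalars_theory.

(** * Weak and weak* topologies *)

(** The weak and the weak* topology are both initial for a map into a space of functions with
    pointwise convergence, so this one criterion serves for both. *)
Lemma cvg_initial_ptws (S : choiceType) (T : Type) (V : topologicalType)
    (f : S -> {ptws T -> V}) (X : Type) (F : set_system X) {FF : Filter F}
    (h : X -> initial_topology f) (s : initial_topology f) :
  h @ F --> s <-> forall t, (fun x => f (h x) t) @ F --> f s t.
Proof.
split=> [hs t A Ast|hs A].
  have : nbhs (f s) [set g : {ptws T -> V} | A (g t)].
    have /cvg_sup/(_ t) : (nbhs (f s) : set_system {ptws T -> V}) --> f s by [].
    move=> H; apply: (H [set g : T -> V | A (g t)]); move: Ast; rewrite nbhsE /= => -[B [oB Bst] BA].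
    rewrite (@nbhsE (initial_topology (fun g : T -> V => g t))) /=.
    by exists [set g : T -> V | B (g t)]; [split=> //; exists B|move=> g /BA].
  move=> fA; have /hs : nbhs s [set x : initial_topology f | A (f x t)].
    exact: (@initial_continuous _ _ f s [set g : {ptws T -> V} | A (g t)] fA).
  by [].
rewrite (@nbhsE (initial_topology f)) => -[_ [[C oC <-] /= Cs] CA].
have fh : ((f \o h) @ F : set_system {ptws T -> V}) --> f s.
  apply/cvg_sup => t B; rewrite (@nbhsE (initial_topology (fun g : T -> V => g t))) /=.
  move=> [_ [[D oD <-] /= Ds] DB]; have := hs t D; rewrite nbhsE => H.
  have /H : exists2 U, open_nbhs (f s t) U & U `<=` D by exists D.
  exact: (@filterS _ F FF [set x | D (f (h x) t)] _ (fun x Dx => DB (f (h x)) Dx)).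
have /fh : nbhs (f s) C by apply: open_nbhs_nbhs.
exact: (@filterS _ F FF [set x | C (f (h x))] _ (fun x Cx => CA (h x) Cx)).
Qed.

Section weak_topologies.
Variables (K : numFieldType) (E : normedModType K).

Lemma cvg_weak_dual (X : Type) (F : set_system X) {FF : Filter F}
    (h : X -> weak_dual E) (l : weak_dual E) :
  h @ F --> l <-> forall x : E, (fun t => h t x) @ F --> l x.
Proof. exact: (@cvg_initial_ptws (weak_dual E) E K^o (@weak_dual_fun K E) X F FF h l). Qed.

Lemma weak_dual_eval_continuous (x : E) :
  continuous (fun mu : weak_dual E => mu x : K^o).
Proof.
move=> mu; have [H _] := @cvg_weak_dual _ (nbhs mu) _ id mu.
by apply: H; exact: cvg_id.
Qed.

Lemma cvg_weak_space (X : Type) (F : set_system X) {FF : Filter F}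
    (h : X -> weak_space E) (l : weak_space E) :
  h @ F --> l <-> forall phi : weak_dual E, (fun t => phi (h t)) @ F --> phi l.
Proof. exact: (@cvg_initial_ptws (weak_space E) (weak_dual E) K^o (@weak_eval K E) X F FF h l). Qed.

Lemma weak_dual_linear (mu : weak_dual E) : linear mu.
Proof. by have /set_mem[] := valP mu. Qed.

Lemma weak_dual_continuous (mu : weak_dual E) : continuous mu.
Proof. by have /set_mem[] := valP mu. Qed.

HB.instance Definition _ (mu : weak_dual E) :=
  GRing.isLinear.Build K E K^o _ mu (weak_dual_linear mu).

Lemma functionalD (mu : weak_dual E) (x y : E) : mu (x + y) = mu x + mu y.
Proof. exact: linearD. Qed.

Lemma functionalB (mu : weak_dual E) (x y : E) : mu (x - y) = mu x - mu y.
Proof. exact: linearB. Qed.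

Lemma functionalZ (mu : weak_dual E) (c : K) (x : E) : mu (c *: x) = c * mu x.
Proof. by rewrite linearZ. Qed.

Lemma functional0 (mu : weak_dual E) : mu 0 = 0.
Proof. exact: linear0. Qed.

Lemma functional_sum (mu : weak_dual E) (I : Type) (s : seq I) (P : pred I) (F : I -> E) :
  mu (\sum_(i <- s | P i) F i) = \sum_(i <- s | P i) mu (F i).
Proof. exact: linear_sum. Qed.

Lemma weak_dualD (mu nu : weak_dual E) x : (mu + nu) x = mu x + nu x.
Proof. by []. Qed.

Lemma weak_dualB (mu nu : weak_dual E) x : (mu - nu) x = mu x - nu x.
Proof. by []. Qed.

Lemma weak_dualZ c (mu : weak_dual E) x : (c *: mu) x = c * mu x.
Proof. by []. Qed.

Lemma weak_dual_ext (mu nu : weak_dual E) : (forall x, mu x = nu x) -> mu = nu.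
Proof. by move=> mn; apply: val_inj; apply/funext. Qed.

Lemma weak_dual_bounded (mu : weak_dual E) :
  exists2 C : K, 0 < C & forall x, `|mu x| <= C * `|x|.
Proof.
have : bounded_near mu (nbhs (0 : E)).
  by apply: continuous_linear_bounded; exact: weak_dual_continuous.
move/linear_boundedP/pinfty_ex_gt0 => [C C0 muC].
by exists C.
Qed.

Lemma bounded_linear_functional (f : E -> K^o) (C : K) :
  0 <= C -> linear f -> (forall x, `|f x| <= C * `|x|) -> f \in @functional K E.
Proof.
move=> C0 lin fC.
pose L := HB.pack f (GRing.isLinear.Build K E K^o _ f lin) : {linear E -> K^o}.
apply: mem_set; split=> //; apply: (@bounded_linear_continuous _ _ _ L).
apply/linear_boundedP; near=> r => x.
rewrite (le_trans (fC x)) // ler_wpM2r //.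
by near: r; apply: nbhs_pinfty_ge; exact: ger0_real.
Unshelve. all: by end_near. Qed.

End weak_topologies.

(** * [0, omega_1] is not an Eberlein compact *)

Section no_weak_copy.
Variables (R : realType) (k : scalar_kind).
Local Notation K := (scalars R k).
Local Notation conj := (@scalar_conj R k).

(** For each [n] the values are within 1 / (n + 1) of [f None] beyond some [u n], and the countably
    many [u n] have a common upper bound. *)
Lemma omega1_top_eventually (f : omega1_top -> K^o) :
  {for (None : omega1_top), continuous f} -> exists a : omega1, forall b, (a <= b)%O -> f (Some b) = f None.
Proof.
move=> /cvg_modulusP fN.
have /choice[u uP] (n : nat) : exists u : omega1, forall b, (u < b)%O ->
    modulus (f (Some b) - f None) < n.+1%:R^-1.
  have := fN n.+1%:R^-1; rewrite invr_gt0 ltr0n => /(_ isT).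
  move=> /omega1_top_nbhsP[_ []].
    by have [w0 _] := omega1_nonempty; exists (Some w0).
  by move=> [a|] // aN H; exists a => b ab; apply: (H (Some b)).
have [a aP] := omega1_seq_ubound u; have [b ab] := omega1_gt a.
exists b => c bc; apply/eqP; rewrite -subr_eq0; apply/eqP/modulus0_eq0/eqP.
rewrite eq_le modulus_ge0 andbT; apply/ler_addgt0Pr => e e0; rewrite add0r.
have [n ne] : exists n, n.+1%:R^-1 < e.
  exists (Num.truncn e^-1); rewrite invf_plt ?posrE //; exact: truncnS_gt.
apply/ltW/(lt_trans _ ne)/uP; exact: le_lt_trans (aP n) (lt_le_trans ab bc).
Qed.

Variables (H : completeNormedModType K) (dot : {dot H for conj}).
Hypothesis dotE : forall x : H, `|x| ^+ 2 = dot x x.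

Lemma dotC u v : dot u v = conj (dot v u).
Proof. by rewrite hermitian_subproof mul1r. Qed.

Lemma dotBl u v w : dot (u - v) w = dot u w - dot v w.
Proof. exact: zmod_morphisml_subproof. Qed.

Lemma dotZl a u w : dot (a *: u) w = a * dot u w.
Proof. exact: linearl_subproof. Qed.

Lemma dot_linear w : linear (fun u : H => dot u w : K^o).
Proof.
move=> a x y; have -> : a *: x + y = a *: x - (- y) by rewrite opprK.
rewrite dotBl dotZl -[- y]sub0r dotBl.
have -> : dot 0 w = 0 by rewrite -[X in dot X w](scale0r 0) dotZl mul0r.
by rewrite sub0r opprK.
Qed.

(** Cauchy-Schwarz: expand [0 <= dot (x - a *: y) (x - a *: y)] with a = <x, y> / |y|^2. *)
Lemma dot_bound (x y : H) : `|dot x y| <= `|y| * `|x|.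
Proof.
have [->|y0] := eqVneq y 0.
  rewrite dotC -[X in dot X x](scale0r 0) dotZl mul0r scalar_conj0.
  by rewrite normr0 mulr_ge0.
set c := dot x y; set N := `|y| ^+ 2.
have N0 : 0 < N by rewrite exprn_gt0 // normr_gt0.
have [n n0 nE] := gt0_of_real N0.
set a := c / N.
have aE : conj a = conj c / N by rewrite /a nE scalar_conjM -of_realV scalar_conj_of_real.
have dotBr u v w : dot u (v - w) = dot u v - dot u w.
  by rewrite dotC dotBl scalar_conjB -!dotC.
have dotZr b u v : dot u (b *: v) = conj b * dot u v.
  by rewrite dotC dotZl scalar_conjM -dotC.
have : 0 <= dot (x - a *: y) (x - a *: y) by rewrite -dotE exprn_ge0.
rewrite dotBl !dotBr !dotZl !dotZr -!dotE -/N [dot y x]dotC -/c aE.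
have -> : `|x| ^+ 2 - conj c / N * c - (a * conj c - a * (conj c / N * N)) =
    `|x| ^+ 2 - (c * conj c) / N.
  by rewrite divfK ?gt_eqF // subrr subr0 [conj c / N * c]mulrAC [conj c * c]mulrC.
rewrite scalar_mul_conj expr2 of_realM -modulusE -expr2 subr_ge0 ler_pdivrMr // mulrC => cN.
have {}cN : `|c| ^+ 2 <= (`|y| * `|x|) ^+ 2 by rewrite exprMn [leRHS]mulrC expr2.
by move: cN; rewrite ler_pXn2r // nnegrE ?mulr_ge0.
Qed.

Definition dot_functional (w : H) : weak_dual H :=
  WeakDual (bounded_linear_functional (normr_ge0 w) (dot_linear w) (dot_bound ^~ w)).

Lemma no_omega1_top_in_weak_space (h : omega1_top -> weak_space H) :
  continuous h -> injective h -> False.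
Proof.
move=> hc hinj.
have hd w : continuous (fun a => dot (h a : H) w : K^o).
  move=> a; have [/(_ (hc a)) H1 _] := @cvg_weak_space _ _ _ (nbhs a) _ h (h a).
  exact: (H1 (dot_functional w)).
pose x (a : omega1) : H := (h (Some a) : H) - (h None : H).
have xd w a : dot (x a) w = dot (h (Some a) : H) w - dot (h None : H) w.
  exact: dotBl.
(* The product of [x c] with [x a] is eventually constant in [c], with value 0 because [x c] is
   measured from [h None]. *)
have nxt (a : omega1) : exists b : omega1, (a < b)%O /\
    forall c, (b <= c)%O -> dot (x c) (x a) = 0.
  have [b bP] := omega1_top_eventually (hd (x a) None).
  have [b' ] := omega1_gt (Order.max a b); rewrite gt_max => /andP[ab' bb'].
  exists b'; split=> // c b'c; rewrite xd bP ?subrr //.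
  by rewrite (le_trans _ b'c) // ltW.
have [g gP] := choice nxt; have [w0 _] := omega1_nonempty.
pose u n := iter n g w0.
have uS n : (u n < u n.+1)%O by have [] := gP (u n).
have [s [us sP]] := omega1_seq_sup uS.
have xs n : dot (x (u n)) (x s) = 0.
  have [_ gs] := gP (u n); rewrite dotC gs ?scalar_conj0 //.
  exact: ltW (us n.+1).
(* The points [u n] converge to [s], so weak continuity of [h] at [s] carries the orthogonality of
   [x (u n)] and [x s] over to [x s] itself. *)
have : dot (x s) (x s) = 0.
  apply: modulus0_eq0; apply/eqP; rewrite eq_le modulus_ge0 andbT.
  apply/ler_addgt0Pr => e e0; rewrite add0r.
  have /cvg_modulusP/(_ e e0) := hd (x s) (Some s).
  move=> /omega1_top_nbhsP[_ []]; first by exists (Some (u 0%N)); exact: us.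
  move=> [b|] //= bs H1; have [n bn] := sP b bs.
  have := H1 (Some (u n)) bn (ltW (us n)) => /ltW; apply: le_trans.
  rewrite modulusBC le_eqVlt; apply/orP; left; apply/eqP; congr modulus.
  have -> : dot (h (Some s) : H) (x s) = dot (x s) (x s) + dot (h None : H) (x s).
    by rewrite xd subrK.
  have -> : dot (h (Some (u n)) : H) (x s) = dot (x (u n)) (x s) + dot (h None : H) (x s).
    by rewrite [dot (x (u n)) _]xd subrK.
  by rewrite xs add0r addrK.
rewrite -dotE => /eqP; rewrite expf_eq0 normr_eq0 /= subr_eq0 => /eqP/hinj.
by [].
Qed.

End no_weak_copy.

(** * Functionals on C_0[0, omega_1) *)

Section C0_theory.
Variables (R : realType) (k : scalar_kind).
Local Notation K := (scalars R k).
Local Notation C0 := (C0 R k).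
Implicit Types (f g h : C0) (mu nu : weak_dual C0) (a b c x : omega1).

Lemma C0_continuous f : continuous f.
Proof. by have /set_mem[] := valP f. Qed.

Lemma C0_vanish f : exists b, forall a, (b <= a)%O -> f a = 0.
Proof. by have /set_mem[] := valP f. Qed.

Lemma C0D f g x : (f + g) x = f x + g x. Proof. by []. Qed.
Lemma C0B f g x : (f - g) x = f x - g x. Proof. by []. Qed.
Lemma C0Z (s : K) f x : (s *: f) x = s * f x. Proof. by []. Qed.

Lemma C0_sum (I : Type) (s : seq I) (P : pred I) (F : I -> C0) x :
  (\sum_(i <- s | P i) F i) x = \sum_(i <- s | P i) F i x.
Proof. by elim/big_rec2: _ => // i y z _ <-. Qed.

(** The indicator of [0, a] is continuous because [0, a] is clopen. *)
Lemma step_subproof a : (fun x => (x <= a)%O%:R : K^o) \in @C0_fun R k.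
Proof.
apply: mem_set; split=> [x|]; last first.
  have [b ab] := omega1_gt a; exists b => c bc.
  by rewrite leNgt (lt_le_trans ab bc).
apply/(@cvg_modulusP _ _ _ (nbhs x)) => e e0; apply/omega1_nbhsP; split=> [|[z zx]].
  by rewrite /= subrr modulus0.
have [xa|ax] := leP x a.
  by exists z => // c _ cx; rewrite (le_trans cx xa) subrr modulus0.
by exists a => // c ac _; rewrite leNgt ac subrr modulus0.
Qed.

Definition step a : C0 := MkC0 (step_subproof a).

Lemma stepE a x : step a x = (x <= a)%O%:R. Proof. by []. Qed.

Lemma sup_norm_gt0 f : f != 0 -> 0 < sup_norm f.
Proof.
move=> f0; rewrite lt_def sup_norm_ge0 andbT; apply: contra_neq f0 => f0.
by apply: sup_norm0_eq0; rewrite f0 of_real0.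
Qed.

Lemma C0_functional_bounded mu :
  exists2 C : R, 0 < C & forall f, modulus (mu f) <= C * sup_norm f.
Proof.
have [_ /gt0_of_real[C Cp ->] muC] := weak_dual_bounded mu.
by exists C => // f; rewrite -(le_of_real k) of_realM -modulusE -C0_normE.
Qed.

(* The steps span a dense subspace: a continuous function is nearly constant
   on some ]b, a], so it can be approximated by induction on the support. *)
Lemma weak_dual_step_ext mu nu :
  (forall a, mu (step a) = nu (step a)) -> mu = nu.
Proof.
move=> mn; apply: weak_dual_ext => f; apply/eqP; rewrite -subr_eq0; apply/eqP.
pose L := mu - nu; change (L f = 0).
have Ls a : L (step a) = 0 by rewrite weak_dualB mn subrr.
have [C Cp LC] := C0_functional_bounded L.
apply: modulus0_eq0; apply/eqP; rewrite eq_le modulus_ge0 andbT.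
apply/ler_addgt0Pr => e e0; rewrite add0r.
have d0 : 0 < e / C by rewrite divr_gt0.
(* [g] lies in the kernel of [L], follows [f] on [0, a] and vanishes beyond; the tolerance [e / C]
   becomes [e] under [L]. *)
have approx a : exists g : C0, [/\ L g = 0,
    forall x, (x <= a)%O -> modulus (f x - g x) <= e / C &
    forall x, (a < x)%O -> g x = 0].
  elim/omega1_ind: a => a IH.
  have := @C0_continuous f a; move=> /cvg_modulusP/(_ _ d0)/omega1_nbhsP[_ fa].
  have [ex|/forallNP na] := pselect (exists b, (b < a)%O); last first.
    exists (f a *: step a); split.
    - by rewrite functionalZ Ls mulr0.
    - move=> x xa; have -> : x = a.
        by apply/eqP; move: xa; rewrite le_eqVlt => /orP[//|/na].
      by rewrite C0Z stepE lexx mulr1 subrr modulus0 ltW.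
    - by move=> x ax; rewrite C0Z stepE leNgt ax mulr0.
  have [b ba bP] := fa ex; have [g [Lg gb g0]] := IH b ba.
  (* [step a - step b] is the indicator of ]b, a], where [f] is within [e / C] of the constant
     [f a]. *)
  exists (g + f a *: (step a - step b)); split.
  - by rewrite functionalD functionalZ functionalB Lg !Ls subrr mulr0 addr0.
  - move=> x xa; rewrite C0D C0Z C0B !stepE xa.
    have [xb|bx] := leP x b; first by rewrite subrr mulr0 addr0 gb.
    by rewrite g0 // subr0 mulr1 add0r ltW // bP.
  - move=> x ax; rewrite C0D C0Z C0B !stepE !leNgt ax (lt_trans ba ax).
    by rewrite subrr mulr0 addr0 g0 // (lt_trans ba ax).
have [b fb] := C0_vanish f; have [g [Lg gb g0]] := approx b.
have -> : L f = L (f - g) by rewrite functionalB Lg subr0.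
apply: le_trans (LC _) _; rewrite mulrC -ler_pdivlMr //.
apply: sup_norm_le => x; rewrite C0B; have [/gb//|bx] := leP x b.
by rewrite g0 // fb ?(ltW bx) // subrr modulus0 (ltW d0).
Qed.

(** The pointwise limit inherits the rate [r], which gives its continuity. It vanishes eventually
    because the countably many points from which the [u n] vanish have a common upper bound. *)
Lemma C0_complete (u : nat -> C0) (r : nat -> R) :
  (forall e, 0 < e -> exists n, r n < e) ->
  (forall n m, (n <= m)%N -> forall x, modulus (u m x - u n x) <= r n) ->
  exists f, forall n x, modulus (f x - u n x) <= r n.
Proof.
move=> r0 ur.
have [U [UU Usub]] := ultraFilterLemma eventually_filter.
have lim x : exists l : K^o, (fun n => u n x : K^o) @ U --> l.
  apply: (@bounded_ultra_cvg _ _ _ U UU _ (modulus (u 0%N x) + r 0%N)).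
  apply: filterE => n.
  by rewrite (le_trans (le_modulus_sub _ (u 0%N x))) // lerD2l ur.
have [f fP] := choice lim.
have fu n x : modulus (f x - u n x) <= r n.
  apply: cvg_modulus_le (fP x) _; apply: Usub; exists n => // m /= nm.
  exact: ur.
have fC0 : f \in @C0_fun R k.
  apply: mem_set; split=> [x|].
    apply/(@cvg_modulusP _ _ _ (nbhs x)) => e e0.
    have e3 : 0 < e / 3 by rewrite divr_gt0.
    have [n rn] := r0 _ e3.
    have := @C0_continuous (u n) x => /cvg_modulusP/(_ _ e3).
    apply: filterS => y un.
    have h1 := fu n y; have h2 := fu n x; rewrite modulusBC in h2.
    have h3 := le_modulusB (f y) (u n y) (f x).
    have h4 := le_modulusB (u n y) (u n x) (f x).
    lra.
  have /choice[b bP] n : exists b, forall a, (b <= a)%O -> u n a = 0.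
    exact: C0_vanish.
  have [c bc] := omega1_seq_ubound b; exists c => a ca.
  apply: modulus0_eq0; apply/eqP; rewrite eq_le modulus_ge0 andbT.
  apply/ler_addgt0Pr => e e0; rewrite add0r; have [n rn] := r0 _ e0.
  by rewrite (le_trans _ (ltW rn)) // -[f a]subr0 -(bP n a) // (le_trans (bc n)).
by exists (MkC0 fC0).
Qed.

(** Functionals of [A] with values at [f] exceeding every [n] would have a cluster point, near which
    evaluation at [f] is bounded. *)
Lemma compact_pointwise_bounded (A : set (weak_dual C0)) f : compact A ->
  exists M : R, forall mu, A mu -> modulus (mu f) <= M.
Proof.
move=> cA; apply: contrapT => /forallNP nM.
have /choice[m mP] (n : nat) : exists mu, A mu /\ n%:R < modulus (mu f).
  have /existsNP[mu /not_implyP[Amu /negP]] := nM n%:R.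
  by rewrite -ltNge => ?; exists mu.
have [|nu [Anu cl]] := cA (m @ \oo) _.
  by exists 0%N => // n _ /=; have [] := mP n.
pose N := Num.truncn (modulus (nu f) + 1).
have e1 : nbhs nu [set mu : weak_dual C0 | modulus (mu f - nu f) < 1].
  by have /cvg_modulusP := @weak_dual_eval_continuous _ _ f nu; apply.
have e2 : (m @ \oo) [set mu : weak_dual C0 | N.+1%:R < modulus (mu f)].
  exists N.+1 => // n /= Nn; have [_] := mP n; apply: le_lt_trans.
  by rewrite ler_nat.
have [mu [/= h1 h2]] := cl _ _ e2 e1.
have h3 := le_modulus_sub (mu f) (nu f).
have := truncnS_gt (modulus (nu f) + 1); rewrite -/N; lra.
Qed.

(* Banach-Steinhaus, by a sequence of nested balls on which some functional of
   [A] exceeds [n]. *)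
Lemma compact_uniformly_bounded (A : set (weak_dual C0)) : compact A ->
  exists2 C : R, 0 < C & forall mu f, A mu -> modulus (mu f) <= C * sup_norm f.
Proof.
move=> cA; apply: contrapT => nC.
(* Pairs in [C0 * {posnum R}] are a centre and a radius. Inside the ball [p.2] there is a ball [q],
   of radius at most 1 / (n + 1) for [n = p.1], on which some functional of [A] has modulus at least
   [n]. *)
have hump (p : nat * (C0 * {posnum R})) : exists q : C0 * {posnum R},
    [/\ forall z : C0, (forall x, modulus (z x - q.1 x) <= q.2%:num) ->
          forall x, modulus (z x - p.2.1 x) <= p.2.2%:num,
        q.2%:num <= p.1.+1%:R^-1 &
        forall z : C0, (forall x, modulus (z x - q.1 x) <= q.2%:num) ->
          exists2 mu, A mu & p.1%:R <= modulus (mu z)].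
  case: p => n [y r] /=.
  have Cp : 0 < n.+1%:R * 2 / r%:num by rewrite divr_gt0 // mulr_gt0.
  have [mu [f Amu]] : exists mu, exists2 f, A mu & n.+1%:R * 2 / r%:num * sup_norm f < modulus (mu f).
    apply: contrapT => nmu; apply: nC; exists (n.+1%:R * 2 / r%:num) => // mu f Amu.
    by rewrite leNgt; apply/negP => ?; apply: nmu; exists mu, f.
  move=> muf; have f0 : f != 0.
    apply: contraTneq muf => ->; rewrite functional0 modulus0 -leNgt.
    by rewrite mulr_ge0 ?sup_norm_ge0 // ltW.
  have s0 := sup_norm_gt0 f0.
  pose t := r%:num / 2 / sup_norm f.
  have t0 : 0 < t by rewrite !divr_gt0.
  pose g := of_real k t *: f.
  have gr x : modulus (g x) <= r%:num / 2.
    rewrite C0Z modulusM modulus_of_real gtr0_norm // /t mulrAC ler_pdivrMr //.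
    by rewrite ler_wpM2l ?le_sup_norm.
  have gmu : n.+1%:R < modulus (mu g).
    rewrite functionalZ /= modulusM modulus_of_real gtr0_norm // /t mulrAC.
    rewrite ltr_pdivlMr //; have r2 : 0 < r%:num / 2 by rewrite divr_gt0.
    move: muf; rewrite -(ltr_pM2l r2); apply: le_lt_trans.
    rewrite le_eqVlt; apply/orP; left; apply/eqP; field.
    by rewrite gt_eqF.
  (* [mu (y + g)] and [mu (y - g)] differ by [2 mu g], of modulus above 2(n + 1), so one of them has
     modulus at least n + 1. *)
  have [y' y'r y'mu] : exists2 y' : C0, forall x, modulus (y' x - y x) <= r%:num / 2 &
      n.+1%:R <= modulus (mu y').
    have [h|h] := leP n.+1%:R (modulus (mu (y + g))).
      by exists (y + g) => // x; rewrite C0D addrAC subrr add0r.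
    exists (y - g) => [x|]; first by rewrite C0B addrAC subrr add0r modulusN.
    move: h gmu; rewrite functionalD functionalB /= => h gmu.
    have h1 := le_modulusB (mu y + mu g) 0 (mu y - mu g).
    have : mu y + mu g - (mu y - mu g) = mu g *+ 2 by rewrite mulr2n; ring.
    move=> e; rewrite e subr0 sub0r modulusN in h1.
    have e2 : modulus (mu g *+ 2) = modulus (mu g) * 2.
      rewrite -[mu g *+ 2]mulr_natr modulusM; congr (_ * _).
      have -> : (2%:R : K) = of_real k 2 by case: (k) => //=; rewrite rmorph_nat.
      by rewrite modulus_of_real normr_nat.
    rewrite e2 in h1; lra.
  have [c c0 muc] := C0_functional_bounded mu.
  (* The three terms of the new radius keep the ball inside the old one, let [mu] vary by at most 1
     on it, so that n + 1 drops to [n] at worst, and force the radii to 0. *)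
  have m0 : 0 < Num.min (r%:num / 2) (Num.min c^-1 n.+1%:R^-1).
    by rewrite !lt_min divr_gt0 // !invr_gt0 c0 ltr0n.
  exists (y', PosNum m0) => /=; split.
  - move=> z zy' x; have h := zy' x.
    have h1 := le_modulusB (z x) (y' x) (y x); have h2 := y'r x.
    move: h; rewrite le_min => /andP[h _]; lra.
  - by rewrite !ge_min lexx !orbT.
  - move=> z zy'; exists mu => //.
    have h : modulus (mu (y' - z)) <= 1.
      apply: le_trans (muc _) _; rewrite mulrC -ler_pdivlMr // div1r.
      apply: sup_norm_le => x; rewrite C0B modulusBC; have := zy' x.
      by rewrite !le_min => /and3P[].
    have h1 := le_modulus_sub (mu y') (mu z).
    rewrite functionalB /= in h.
    have h2 : n.+1%:R = n%:R + 1 :> R by rewrite -natr1.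
    rewrite h2 in y'mu; lra.
have [F FP] := choice hump.
pose s := fix s n : C0 * {posnum R} := if n is n'.+1 then F (n', s n') else (0, PosNum ltr01).
have sS n : s n.+1 = F (n, s n) by [].
have [] := @C0_complete (fun n => (s n.+1).1) (fun n => (s n.+1).2%:num).
- move=> e e0; exists (Num.truncn e^-1).
  have [_ h _] := FP (Num.truncn e^-1, s (Num.truncn e^-1)); apply: le_lt_trans h _.
  by rewrite /= invf_plt ?posrE // truncnS_gt.
- move=> n m nm x.
  suff H (z : C0) : (forall x, modulus (z x - (s m.+1).1 x) <= (s m.+1).2%:num) ->
      forall x, modulus (z x - (s n.+1).1 x) <= (s n.+1).2%:num.
    by apply: H => w; rewrite subrr modulus0.
  elim: m nm => [|m IH]; first by rewrite leqn0 => /eqP ->.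
  rewrite leq_eqVlt => /orP[/eqP -> //|nm] zs; apply: (IH nm) => w.
  by have [h _ _] := FP (m.+1, s m.+1); exact: (h z zs w).
(* [z] lies in all the balls, so some functional of [A] exceeds the pointwise bound [M] at [z]. *)
move=> z zs; have [M MP] := compact_pointwise_bounded z cA.
pose n := (Num.truncn M).+1.
have [_ _ /(_ z (zs n))[mu Amu]] := FP (n, s n); apply/negP; rewrite -ltNge.
by apply: le_lt_trans (MP _ Amu) _; exact: truncnS_gt.
Qed.

(* Otherwise disjoint intervals on which [mu] has mass more than [e] would
   produce functions of norm one with [mu h] arbitrarily large. *)
Lemma step_cauchy mu (I : set omega1) (e : R) : I !=set0 -> 0 < e ->
  exists2 b, I b & forall c d, I c -> I d -> (b <= c)%O -> (b <= d)%O ->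
    modulus (mu (step c) - mu (step d)) <= e.
Proof.
move=> [b0 Ib0] e0; apply: contrapT => nb.
(* [h] collects [n] disjoint intervals ]c, d] with end points in [I], each multiplied by a phase
   that makes its contribution real and larger than [e]; the part beyond [b] is still free. *)
have H n : exists2 b, I b & exists h : C0, [/\ forall x, modulus (h x) <= 1,
    forall x, (b < x)%O -> h x = 0 & exists2 t, mu h = of_real k t & n%:R * e <= t].
  elim: n => [|n [b Ib [h [h1 hb [t muh tn]]]]].
    exists b0 => //; exists 0; split=> [x|//|]; first by rewrite modulus0.
    by exists 0; rewrite ?functional0 ?of_real0 // mul0r.
  have [c [d [Ic Id bc cd mcd]]] : exists c d, [/\ I c, I d, (b <= c)%O, (c < d)%O &
      e < modulus (mu (step d) - mu (step c))].
    apply: contrapT => ncd; apply: nb; exists b => // c d Ic Id bc bd.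
    rewrite leNgt; apply/negP => ecd; apply: ncd.
    have [cd|dc|cd] := ltgtP c d.
    - by exists c, d; split=> //; rewrite modulusBC.
    - by exists d, c; split.
    - by move: ecd; rewrite cd subrr modulus0 => /lt_trans/(_ e0); rewrite ltxx.
  have [s [s1 sE]] := scalar_signP (mu (step d) - mu (step c)).
  exists d => //; exists (h + s *: (step d - step c)); split=> [x|x dx|].
  - rewrite C0D C0Z C0B !stepE; have [xc|cx] := leP x c.
      by rewrite (le_trans xc (ltW cd)) subrr mulr0 addr0.
    rewrite hb ?(le_lt_trans bc) // add0r subr0 modulusM.
    have [_|_] := leP x d; last by rewrite modulus0 mulr0.
    by rewrite modulus1 mulr1.
  - rewrite C0D C0Z C0B !stepE !leNgt dx (lt_trans cd dx) subrr mulr0 addr0 hb //.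
    exact: le_lt_trans bc (lt_trans cd dx).
  - exists (t + modulus (mu (step d) - mu (step c))).
      by rewrite functionalD functionalZ functionalB /= muh of_realD -sE.
    rewrite -natr1 mulrDl mul1r lerD // ltW //.
have [C Cp muC] := C0_functional_bounded mu.
have [b _ [h [h1 _ [t muh tn]]]] := H (Num.truncn (C / e)).+1.
have : modulus (mu h) <= C.
  by apply: le_trans (muC h) _; rewrite ler_piMr ?(ltW Cp) //; exact: sup_norm_le.
rewrite muh modulus_of_real => /(le_trans (ler_norm _))/(le_trans tn).
rewrite -ler_pdivlMr //; apply/negP; rewrite -ltNge; exact: truncnS_gt.
Qed.

(** Beyond [u n] the step values oscillate by at most 1 / (n + 1), so beyond a common bound of all
    [u n] they do not oscillate at all. *)
Lemma step_total mu : exists t : K, exists b, forall c, (b <= c)%O -> mu (step c) = t.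
Proof.
have /choice[u uP] (n : nat) : exists b, forall c d, (b <= c)%O -> (b <= d)%O ->
    modulus (mu (step c) - mu (step d)) <= n.+1%:R^-1.
  have [|b _ bP] := @step_cauchy mu setT n.+1%:R^-1 omega1_nonempty.
    by rewrite invr_gt0.
  by exists b => c d; exact: bP.
have [b ub] := omega1_seq_ubound u; exists (mu (step b)), b => c bc.
apply/eqP; rewrite -subr_eq0; apply/eqP/modulus0_eq0/eqP.
rewrite eq_le modulus_ge0 andbT; apply/ler_addgt0Pr => e e0; rewrite add0r.
have := uP (Num.truncn e^-1) c b (le_trans (ub _) bc) (ub _); move/le_trans; apply.
by rewrite ltW // invf_plt ?posrE // truncnS_gt.
Qed.

End C0_theory.

(** * Copies of [0, omega_1] *)

Section delta_copies.
Variables (R : realType) (k : scalar_kind).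
Local Notation K := (scalars R k).
Local Notation C0 := (C0 R k).
Implicit Types (mu nu rho : weak_dual C0) (a b c : omega1).

Lemma delta_step a c : delta R k a (step R k c) = (a <= c)%O%:R.
Proof. by []. Qed.

Section homeomorphism.
Variables (rho : weak_dual C0) (lambda : K) (D : set omega1).
Hypotheses (lambda0 : lambda != 0) (clubD : club D).
Local Notation copy := (delta_copy rho lambda D).

(** The map sends [a] to [rho + lambda *: delta (e a)], with [e] the continuous enumeration of [D],
    and omega_1 to [rho]. The steps at the points [e c] recover the order, hence injectivity and
    continuity of the inverse. *)
Lemma delta_copy_homeomorphic : homeomorphic omega1_top copy.
Proof.
have [e [einc ege eD eonto econt]] := club_enumeration clubD.
pose phi (x : omega1_top) : weak_dual C0 :=
  if x is Some a then rho + lambda *: delta R k (e a) else rho.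
have phiE x c : phi x (step R k (e c)) =
    rho (step R k (e c)) + lambda * (x <= Some c :> omega1_top)%O%:R.
  case: x => [a|]; rewrite /phi; last first.
    have -> : (None <= Some c :> omega1_top)%O = false by [].
    by rewrite mulr0 addr0.
  rewrite weak_dualD weak_dualZ delta_step; congr (_ + _ * _%:R).
  have -> : (Some a <= Some c :> omega1_top)%O = (a <= c)%O by [].
  have [/einc/ltW->//|ca|->] := ltgtP a c; last by rewrite lexx.
  by rewrite leNgt einc.
have phi_in x : copy (phi x).
  by case: x => [a|]; [left; exists (e a)|right].
have phi_onto nu : copy nu -> exists x, phi x = nu.
  by move=> [[d /eonto[a <-] <-]|->]; [exists (Some a)|exists None].
(* At the step of [e c] two points of the copy differ by 0 or by a scalar of modulus |lambda|; a
   smaller distance puts [x] and [y] on the same side of [c]. *)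
have le_eq (x y : omega1_top) (c : omega1) : modulus (phi x (step R k (e c)) - phi y (step R k (e c))) < modulus lambda ->
    (x <= Some c)%O = (y <= Some c)%O.
  rewrite !phiE opprD addrACA subrr add0r -mulrBr modulusM.
  have l0 : 0 < modulus lambda by rewrite modulus_gt0.
  by do 2 case: (_ <= _)%O => //=; rewrite ?subr0 ?sub0r ?modulusN ?modulus1 mulr1 ltxx.
have phi_inj : injective phi.
  move=> x y xy.
  have H c : (x <= Some c)%O = (y <= Some c)%O.
    by apply: le_eq; rewrite xy subrr modulus0 modulus_gt0.
  apply/eqP; rewrite eq_le; apply/andP; split.
    by case: y xy H => [b _ ->|]; rewrite ?lexx //; case: x.
  by case: x xy H => [b _ <-|]; rewrite ?lexx //; case: y.
have phi_cont : continuous phi.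
  move=> x; apply/(@cvg_weak_dual _ _ _ (nbhs x)) => f.
  apply/(@cvg_modulusP _ _ _ (nbhs x)) => d d0; apply/omega1_top_nbhsP.
  split=> [|[z zx]]; first by rewrite subrr modulus0.
  case: x zx => [a|] zx.
    case: z zx => [z|//] za.
    have : nbhs a [set b | modulus (lambda * f (e b) - lambda * f (e a)) < d].
      have : (fun b => f (e b) : K^o) @ nbhs a --> (f (e a) : K^o).
        apply: (@continuous_comp _ _ _ e (C0_val f) a); first exact: econt.
        exact: C0_continuous.
      have l0 : 0 < modulus lambda by rewrite modulus_gt0.
      move=> /cvg_modulusP/(_ _ (divr_gt0 d0 l0)); apply: filterS => b bd.
      by rewrite /= -mulrBr modulusM mulrC -ltr_pdivlMr.
    move=> /omega1_nbhsP[_ []]; first by exists z.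
    move=> b ba bP; exists (Some b) => // -[c|//] bc ca.
    by rewrite [phi _ f]/(rho f + _) [phi (Some a) f]/(rho f + _) opprD addrACA subrr add0r bP.
  have [b fb] := C0_vanish f; exists (Some b) => // -[c|] bc _; last by rewrite subrr modulus0.
  rewrite weak_dualD weak_dualZ addrAC subrr add0r.
  have -> : delta R k (e c) f = f (e c) by [].
  by rewrite fb ?mulr0 ?modulus0 // (le_trans (ltW bc : (b <= c)%O)) // ege.
pose f (x : omega1_top) : copy := exist _ (phi x) (mem_set (phi_in x)).
have gex (y : copy) : exists x, phi x = set_val y.
  by apply: phi_onto; exact: set_mem (valP y).
have [g gP] := choice gex.
have gK : cancel g f by move=> y; apply: val_inj; exact: gP.
exists f, g; split=> //.
- by move=> x; apply: phi_inj; rewrite gP.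
- by apply: continuous_comp_initial.
move=> y U /omega1_top_nbhsP[Ugy Ub].
have near_le c : \forall y' \near y, (g y' <= Some c)%O = (g y <= Some c)%O.
  have l0 : 0 < modulus lambda by rewrite modulus_gt0.
  have cv : (fun y' : copy => set_val y' (step R k (e c)) : K^o) @ nbhs y -->
      (set_val y (step R k (e c)) : K^o).
    apply: (@continuous_comp _ _ _ (set_val : copy -> weak_dual C0)
      (fun mu : weak_dual C0 => mu (step R k (e c)) : K^o) y).
      exact: initial_continuous.
    exact: weak_dual_eval_continuous.
  move/cvg_modulusP: cv => /(_ _ l0); apply: filterS => y' y'P.
  by apply: le_eq; rewrite !gP.
case gy : (g y) => [a|]; rewrite gy in Ugy Ub near_le.
  have [[z za]|/forallNP nz] := pselect (exists b : omega1_top, (b < Some a)%O); last first.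
    apply: (@filterS _ (nbhs y) _ _ _ _ (near_le a)) => y' /= H.
    suff -> : g y' = Some a by [].
    by apply/eqP; move: H; rewrite lexx le_eqVlt => /orP[//|/nz].
  have [|b ba bU] := Ub; first by exists z.
  case: b ba bU => [b|//] ba bU.
  have h1 := near_le a; have h2 := near_le b.
  apply: (@filterS _ (nbhs y) _ _ _ _ (filterI h1 h2)) => y' /= [H1 H2].
  by apply: bU; [rewrite ltNge H2 -ltNge|rewrite H1 lexx].
have [|b bN bU] := Ub; first by have [w0 _] := omega1_nonempty; exists (Some w0).
case: b bN bU => [b|//] bN bU; apply: (@filterS _ (nbhs y) _ _ _ _ (near_le b)) => y' /= H.
by apply: bU; [rewrite ltNge H|case: (g y')].
Qed.

End homeomorphism.

(** The sets of approximants generate a filter; a cluster point of it in [A] has the same steps as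
    [nu], and steps determine a functional. *)
Lemma compact_step_closed (A : set (weak_dual C0)) nu : compact A ->
  (forall (X : {fset omega1}) n, exists2 mu, A mu & forall c, c \in X ->
    modulus (mu (step R k c) - nu (step R k c)) < n.+1%:R^-1) -> A nu.
Proof.
move=> cA H.
pose B (p : {fset omega1} * nat) := [set mu | A mu /\ forall c, c \in p.1 ->
    modulus (mu (step R k c) - nu (step R k c)) < p.2.+1%:R^-1].
pose G := filter_from [set: {fset omega1} * nat] B.
have GF : ProperFilter G.
  apply: filter_from_proper; last by move=> [X n] _; have [mu Amu muP] := H X n; exists mu.
  apply: filter_from_filter; first by exists (fset0, 0%N).
  move=> [X n] [Y m] _ _; exists ((X `|` Y)%fset, maxn n m) => // mu [Amu muP].
  have le p : (p <= maxn n m)%N -> (maxn n m).+1%:R^-1 <= p.+1%:R^-1 :> R.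
    by move=> pm; rewrite lef_pV2 ?posrE // ler_nat.
  split; split=> // c cX; apply: lt_le_trans (muP c _) (le _ _);
    by rewrite ?leq_maxl ?leq_maxr //= in_fsetU cX ?orbT.
have [|mu [Amu cl]] := cA G GF; first by exists (fset0, 0%N) => // mu [].
suff -> : nu = mu by [].
apply: weak_dual_step_ext => c; apply/eqP; rewrite -subr_eq0; apply/eqP.
apply: modulus0_eq0; apply/eqP; rewrite eq_le modulus_ge0 andbT.
apply/ler_addgt0Pr => e e0; rewrite add0r.
have e2 : 0 < e / 2 by rewrite divr_gt0.
pose n := Num.truncn (e / 2)^-1.
have ne : n.+1%:R^-1 < e / 2 by rewrite invf_plt ?posrE // truncnS_gt.
have h1 : G (B ([fset c]%fset, n)) by exists ([fset c]%fset, n).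
have h2 : nbhs mu [set mu' : weak_dual C0 | modulus (mu' (step R k c) - mu (step R k c)) < e / 2].
  by have /cvg_modulusP := @weak_dual_eval_continuous _ _ (step R k c) mu; apply.
have [mu' [[_ /(_ c)]]] := cl _ _ h1 h2; rewrite in_fset1 eqxx => /(_ isT) /= h3 /= h4.
rewrite (le_trans (le_modulusB _ (mu' (step R k c)) _)) // modulusBC (splitr e).
by rewrite lerD // ltW // (lt_trans h3).
Qed.

(** [t] is the mass that [mu], seen as a measure, gives to the whole of [0, omega_1). *)
Definition step_tot mu (t : K) := exists b, forall c, (b <= c)%O -> mu (step R k c) = t.

(** Closing off controls one [b < a] at a time; this places all test points below [a] under such a
    [b]. *)
Lemma fset_lt_bound (X : {fset omega1}) a : (exists z, (z < a)%O) ->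
  exists2 b, (b < a)%O & forall c, c \in X -> (c < a)%O -> (c <= b)%O.
Proof.
move=> [z za]; have [b ba bP] : exists2 b, (b < a)%O &
    forall c, c \in enum_fset X -> (c < a)%O -> (c <= b)%O.
  elim: (enum_fset X) => [|x s [b ba bP]]; first by exists z.
  have [xa|ax] := ltP x a.
    exists (Order.max x b); first by rewrite gt_max xa.
    move=> c; rewrite inE => /orP[/eqP->|cs] ca; first by rewrite le_max lexx.
    by rewrite le_max bP ?orbT.
  exists b => // c; rewrite inE => /orP[/eqP->|]; last exact: bP.
  by rewrite ltNge ax.
by exists b.
Qed.

Lemma contains_delta_copy_of_drift (A : set (weak_dual C0)) (e : R) b0 :
  compact A -> 0 < e ->
  (forall a, exists mu t, [/\ A mu, step_tot mu t & forall c, (b0 <= c)%O -> (c < a)%O ->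
     e <= modulus (t - mu (step R k c))]) ->
  contains_delta_copy A.
Proof.
move=> cA e0 drift.
have /choice[m mP] a : exists p : weak_dual C0 * K * omega1, [/\ A p.1.1,
    forall c, (p.2 <= c)%O -> p.1.1 (step R k c) = p.1.2 &
    forall c, (b0 <= c)%O -> (c < a)%O -> e <= modulus (p.1.2 - p.1.1 (step R k c))].
  by have [mu [t [Amu [z zP] H]]] := drift a; exists (mu, t, z).
pose mm a := (m a).1.1; pose T a : K^o := (m a).1.2; pose Z a := (m a).2.
pose G := filter_from [set: omega1] (fun a => [set b | (a <= b)%O]).
have [w0 _] := omega1_nonempty.
have GF : ProperFilter G.
  apply: filter_from_proper; last by move=> a _; exists a; rewrite /= lexx.
  apply: filter_from_filter; first by exists w0.
  move=> a b _ _; exists (Order.max a b) => // c /=.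
  by rewrite ge_max => /andP[].
(* Along an ultrafilter containing every tail of omega_1 the functionals converge by compactness of
   [A], and their total masses because they are bounded. *)
have [U [UU GU]] := ultraFilterLemma GF.
have Utail a : U [set b | (a < b)%O].
  have [b ab] := omega1_gt a; apply: GU; exists b => // c /=.
  exact: lt_le_trans.
have [rho [Arho mrho]] : A `&` [set p | mm @ U --> p] !=set0.
  move: (cA); rewrite compact_ultra => /(_ (mm @ U)); apply.
    exact: ultra_fmap.
  by apply: (@filterE _ U) => a /=; have [] := mP a.
have [C C0 AC] := compact_uniformly_bounded cA.
have [t Tt] : exists t : K^o, T @ U --> t.
  apply: (@bounded_ultra_cvg _ _ _ U UU _ C); apply: filterE => a.
  have [Am mZ _] := mP a; rewrite /T -(mZ (Z a)) //.
  apply: le_trans (AC _ _ Am) _; rewrite ler_piMr ?(ltW C0) //.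
  by apply: sup_norm_le => x; rewrite stepE; case: (x <= Z a)%O; rewrite ?modulus1 ?modulus0 ?ler01.
have [trho [zrho rhoP]] := step_total rho.
pose lambda : K := t - trho.
have mc c : (fun a => mm a (step R k c) : K^o) @ U --> (rho (step R k c) : K^o).
  by have [H _] := @cvg_weak_dual _ _ _ U _ mm rho; exact: H.
(* Testing at one [c] past [b0] and [zrho], where [rho] has attained its total mass, carries the gap
   [e] to the limit. *)
have lambda_ge : e <= modulus lambda.
  apply/ler_addgt0Pr => d d0; have d2 : 0 < d / 2 by rewrite divr_gt0.
  pose c := Order.max b0 zrho.
  have /cvg_modulusP/(_ _ d2) h1 := mc c.
  have /cvg_modulusP/(_ _ d2) h2 := Tt.
  have [a [[/= ha hb] /= ca]] := @filter_ex _ U _ _ (filterI (filterI h1 h2) (Utail c)).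
  have [_ _ /(_ c)] := mP a; rewrite le_max lexx => /(_ isT ca) h.
  have := rhoP c; rewrite le_max lexx orbT => /(_ isT) rc; rewrite rc in ha.
  have h3 := le_modulusB (T a) t (mm a (step R k c)).
  have h4 := le_modulusB t trho (mm a (step R k c)).
  rewrite modulusBC in ha; apply: le_trans h _.
  apply: le_trans h3 _; rewrite /lambda; lra.
have lambda0 : lambda != 0 by rewrite -modulus_gt0 (lt_le_trans e0).
(* [w (X, n)] is an index whose total mass and steps on the finite set [X] are within 1 / (n + 1) of
   their limits; for infinite [X] the value [w0] is a default. *)
have /choice[w wP] (p : set omega1 * nat) : exists a, finite_set p.1 ->
    modulus (T a - t) < p.2.+1%:R^-1 /\ forall c, p.1 c ->
    modulus (mm a (step R k c) - rho (step R k c)) < p.2.+1%:R^-1.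
  case: p => X n /=; have [/finite_fsetP[Y ->]|nX] := pselect (finite_set X); last by exists w0.
  have n0 : 0 < n.+1%:R^-1 :> R by rewrite invr_gt0.
  have /cvg_modulusP/(_ _ n0) h1 := Tt.
  have h2 : U (\bigcap_(c in [set` Y]) [set a |
      modulus (mm a (step R k c) - rho (step R k c)) < n.+1%:R^-1]).
    by apply: filter_bigI => c _; have /cvg_modulusP := mc c; apply.
  by have [a [ha hb]] := @filter_ex _ U _ _ (filterI h1 h2); exists a.
(* [0, b] has only countably many finite subsets, so one [z] bounds all the points [Z] from which
   the selected functionals have constant steps. *)
have /choice[Phi PhiP] b : exists z, forall X n, finite_set X ->
    (forall c, X c -> (c <= b)%O) -> (Z (w (X, n)) <= z)%O.
  have [|z zP] := @omega1_countable_ubound ((Z \o w) @`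
      ([set X | X `<=` [set c | (c <= b)%O] /\ finite_set X] `*` [set: nat])).
    apply: sub_countable (card_image_le _ _) _; apply: countableX => //.
    exact/countable_finite_subset/omega1_countable.
  by exists z => X n fX Xb; apply: zP; exists (X, n).
pose D := [set a | (zrho < a)%O /\ forall b, (b < a)%O -> (Phi b < a)%O].
have clubD : club D by exact: closing_club.
have copyA : delta_copy rho lambda D `<=` A.
  move=> _ [[a [za aD] <-]|-> //]; apply: compact_step_closed => // X n.
  have [|b ba bP] := @fset_lt_bound X a; first by exists zrho.
  (* Tests [c < a] are met by the choice of [al]. For [c >= a] the step value of [mm al] is already
     [T al], close to [t = trho + lambda], since [Z al < a]. *)
  pose Y := [set c | c \in X /\ (c < a)%O].
  have fY : finite_set Y by apply: sub_finite_set (finite_fset X) => c [].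
  have [hT hc] := wP (Y, n) fY; set al := w (Y, n) in hT hc *.
  have Za : (Z al < a)%O.
    by apply: le_lt_trans (aD b ba); apply: PhiP => // c [cX ca]; exact: bP.
  have [Am mZ _] := mP al; exists (mm al) => // c cX.
  rewrite weak_dualD weak_dualZ delta_step; have [ac|ca] := leP a c.
    rewrite mulr1 [X in modulus (X - _)]mZ ?(le_trans (ltW Za)) //.
    by rewrite rhoP ?(le_trans (ltW za)) // /lambda [trho + _]addrC subrK.
  by rewrite mulr0 addr0 hc.
by exists rho, lambda, D; split=> //; exact: delta_copy_homeomorphic.
Qed.

End delta_copies.

(** * The Hilbert space l_2(I) *)

Lemma big_fset_subset (I : choiceType) (V : zmodType) (F : I -> V) (A B : {fset I}) :
  (A `<=` B)%fset -> \sum_(i <- B) F i = \sum_(i <- A) F i + \sum_(i <- (B `\` A)%fset) F i.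
Proof.
move=> /fsubsetP AB; rewrite (big_fsetID _ (mem A)) /=; congr (_ + _).
  by apply: eq_fbigl => i; rewrite !inE /= andb_idl // => /AB.
by apply: eq_fbigl => i; rewrite !inE /= andbC.
Qed.

Definition fset_tail (I : choiceType) : set_system {fset I} :=
  filter_from setT (fun A => [set B | (A `<=` B)%fset]).

Lemma fset_tail_proper (I : choiceType) : ProperFilter (@fset_tail I).
Proof.
apply: filter_from_proper; last by move=> A _; exists A; exact: fsubset_refl.
apply: filter_from_filter; first by exists fset0%fset.
move=> A B _ _; exists (A `|` B)%fset => // C /=.
by rewrite fsubUset => /andP[].
Qed.

(** Sums over [I] are limits of finite partial sums along this fixed ultrafilter, which contains all
    finite sets above a given one. *)
Definition fset_ultra (I : choiceType) : set_system {fset I} :=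
  sval (cid (ultraFilterLemma (fset_tail_proper I))).

#[global] Instance fset_ultra_ultra (I : choiceType) : UltraFilter (@fset_ultra I).
Proof. by rewrite /fset_ultra; case: cid => U []. Qed.

Lemma fset_ultra_tail (I : choiceType) (A : {fset I}) :
  fset_ultra (fun B => (A `<=` B)%fset).
Proof. by rewrite /fset_ultra; case: cid => U [_ /=]; apply; exists A. Qed.

Section l2.
Variables (R : realType) (k : scalar_kind) (I : choiceType).
Local Notation K := (scalars R k).
Local Notation conj := (@scalar_conj R k).
Implicit Types J : {fset I}.

Definition sqsum J (x : I -> K^o) : R := \sum_(i <- J) modulus (x i) ^+ 2.

Lemma sqsum_ge0 J x : 0 <= sqsum J x.
Proof. by apply: sumr_ge0 => i _; rewrite sqr_ge0. Qed.

Lemma sqsumD J (x y : I -> K^o) : sqsum J (x + y) <= 2 * sqsum J x + 2 * sqsum J y.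
Proof.
rewrite /sqsum !mulr_sumr -big_split /=; apply: ler_sum => i _.
have h := le_modulusD (x i) (y i).
have h1 := modulus_ge0 (x i + y i); have h2 := sqr_ge0 (modulus (x i) - modulus (y i)).
rewrite (@le_trans _ _ ((modulus (x i) + modulus (y i)) ^+ 2)) ?ler_sqr ?nnegrE ?addr_ge0 ?modulus_ge0 //.
rewrite sqrrB in h2; rewrite sqrrD; lra.
Qed.

Lemma sqsumZ J c (x : I -> K^o) : sqsum J (c *: x) = modulus c ^+ 2 * sqsum J x.
Proof.
by rewrite /sqsum mulr_sumr; apply: eq_bigr => i _; rewrite [(c *: x) i]/(c * x i) modulusM exprMn.
Qed.

Lemma sqsum_subset J J' x : (J `<=` J')%fset -> sqsum J x <= sqsum J' x.
Proof. by move=> JJ'; rewrite /sqsum (big_fset_subset _ JJ') lerDl sumr_ge0 // => i _; rewrite sqr_ge0. Qed.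

Definition l2_fun : {pred I -> K^o} :=
  mem [set x : I -> K^o | exists M : R, forall J, sqsum J x <= M].

Lemma l2_submod_closed : submod_closed l2_fun.
Proof.
split=> [|c x y].
  apply: mem_set; exists 0 => J; rewrite /sqsum big1 // => i _; by rewrite modulus0 expr0n.
move=> /set_mem[M xM] /set_mem[N yN]; apply: mem_set; exists (2 * (modulus c ^+ 2 * M) + 2 * N) => J.
rewrite (le_trans (sqsumD _ _ _)) // lerD //; rewrite ler_pM2l //.
by rewrite sqsumZ ler_wpM2l ?sqr_ge0.
Qed.

HB.instance Definition _ :=
  GRing.isSubmodClosed.Build _ _ l2_fun l2_submod_closed.

Record l2 := MkL2 { l2_val :> I -> K^o ; _ : l2_val \in l2_fun }.

HB.instance Definition _ := [isSub for l2_val].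
HB.instance Definition _ := [Choice of l2 by <:].
HB.instance Definition _ := [SubChoice_isSubLmodule of l2 by <:].

Implicit Types x y z : l2.

Lemma l2B x y i : (x - y) i = x i - y i. Proof. by []. Qed.
Lemma l2Z c x i : (c *: x) i = c * x i. Proof. by []. Qed.

Lemma l2_sum (T : Type) (s : seq T) (P : pred T) (F : T -> l2) i :
  (\sum_(t <- s | P t) F t) i = \sum_(t <- s | P t) F t i.
Proof. by elim/big_rec2: _ => // t y z _ <-. Qed.

Definition l2_norm x : R := Num.sqrt (sup [set sqsum J x | J in [set: {fset I}]]).

Lemma l2_has_sup x : has_sup [set sqsum J x | J in [set: {fset I}]].
Proof.
split; first by exists (sqsum fset0%fset x), fset0%fset.
by have /set_mem[M xM] := valP x; exists M => _ [J _ <-].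
Qed.

Lemma sup_sqsum_ge0 x : 0 <= sup [set sqsum J x | J in [set: {fset I}]].
Proof.
apply: le_trans (sqsum_ge0 fset0%fset x) _; apply: ub_le_sup; first by case: (l2_has_sup x).
by exists fset0%fset.
Qed.

Lemma l2_norm_ge0 x : 0 <= l2_norm x. Proof. exact: sqrtr_ge0. Qed.

Lemma le_l2_norm x J : sqsum J x <= l2_norm x ^+ 2.
Proof.
rewrite sqr_sqrtr ?sup_sqsum_ge0 //; apply: ub_le_sup; first by case: (l2_has_sup x).
by exists J.
Qed.

Lemma l2_norm_le x M : 0 <= M -> (forall J, sqsum J x <= M ^+ 2) -> l2_norm x <= M.
Proof.
move=> M0 xM; rewrite -(ger0_norm M0) -sqrtr_sqr ler_sqrt ?sqr_ge0 //.
by apply: ge_sup => [|_ [J _ <-]//]; case: (l2_has_sup x).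
Qed.

Lemma le_l2_norm_coord x i : modulus (x i) <= l2_norm x.
Proof.
rewrite -ler_sqr ?nnegrE ?modulus_ge0 ?l2_norm_ge0 //.
by apply: le_trans (le_l2_norm x [fset i]%fset); rewrite /sqsum big_seq_fset1.
Qed.

(* Convexity: [(a + b)^2 <= (A + B)(a^2 / A + b^2 / B)]. *)
Lemma le_l2_normD_gt x y (A B : R) :
  l2_norm x < A -> l2_norm y < B -> l2_norm (x + y) <= A + B.
Proof.
move=> xA yB; have A0 := le_lt_trans (l2_norm_ge0 x) xA.
have B0 := le_lt_trans (l2_norm_ge0 y) yB.
apply: l2_norm_le => [|J]; first by rewrite addr_ge0 // ltW.
have sq (z : l2) C : l2_norm z < C -> sqsum J z <= C ^+ 2.
  move=> zC; apply: le_trans (le_l2_norm z J) _.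
  by rewrite ler_sqr ?nnegrE ?l2_norm_ge0 ?ltW // (le_lt_trans (l2_norm_ge0 z)).
apply: (@le_trans _ _ ((A + B) * (sqsum J x / A + sqsum J y / B))); last first.
  by rewrite expr2 ler_wpM2l ?(addr_ge0 (ltW A0) (ltW B0)) // lerD // ler_pdivrMr // -expr2 sq.
rewrite /sqsum !mulr_suml -big_split mulr_sumr /=; apply: ler_sum => i _.
apply: (@le_trans _ _ ((modulus (x i) + modulus (y i)) ^+ 2)).
  by rewrite ler_sqr ?nnegrE ?addr_ge0 ?modulus_ge0 // le_modulusD.
rewrite -subr_ge0; set a := modulus (x i); set b := modulus (y i).
have -> : (A + B) * (a ^+ 2 / A + b ^+ 2 / B) - (a + b) ^+ 2 =
    (a * B - b * A) ^+ 2 / (A * B).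
  by field; rewrite !gt_eqF.
by rewrite divr_ge0 ?sqr_ge0 // mulr_ge0 // ltW.
Qed.

Lemma l2_normD x y :
  of_real k (l2_norm (x + y)) <= of_real k (l2_norm x) + of_real k (l2_norm y).
Proof.
rewrite -of_realD le_of_real; apply/ler_addgt0Pr => e e0.
have e2 : 0 < e / 2 by rewrite divr_gt0.
rewrite (splitr e) addrACA.
by apply: le_l2_normD_gt; rewrite ltrDl.
Qed.

Lemma le_l2_normZ c x : l2_norm (c *: x) <= modulus c * l2_norm x.
Proof.
apply: l2_norm_le => [|J]; first by rewrite mulr_ge0 ?modulus_ge0 ?l2_norm_ge0.
by rewrite [sqsum J _]sqsumZ exprMn ler_wpM2l ?sqr_ge0 ?le_l2_norm.
Qed.

Lemma l2_normZ c x : of_real k (l2_norm (c *: x)) = `|c| * of_real k (l2_norm x).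
Proof.
rewrite modulusE -of_realM; congr (of_real k _); apply/eqP.
rewrite eq_le le_l2_normZ /=.
have [->|c0] := eqVneq c 0; first by rewrite modulus0 mul0r l2_norm_ge0.
rewrite -{1}[x](scalerK c0) mulrC -ler_pdivlMr ?modulus_gt0 //.
apply: le_trans (le_l2_normZ _ _) _; rewrite mulrC ler_wpM2l ?l2_norm_ge0 //.
rewrite -(ler_pM2r (x := modulus c)) ?modulus_gt0 // mulVf ?gt_eqF ?modulus_gt0 //.
by rewrite -modulusM mulVf // modulus1.
Qed.

Lemma l2_norm0_eq0 x : of_real k (l2_norm x) = 0 -> x = 0.
Proof.
rewrite -(of_real0 R k) => /of_real_inj x0; apply: val_inj; apply/funext => i.
apply: modulus0_eq0; apply/eqP; rewrite eq_le modulus_ge0 andbT -x0.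
exact: le_l2_norm_coord.
Qed.

HB.instance Definition _ :=
  Lmodule_isNormed.Build K l2 l2_normD l2_normZ l2_norm0_eq0.

Lemma l2_normE x : `|x| = of_real k (l2_norm x). Proof. by []. Qed.

Lemma l2_normBC x y : l2_norm (x - y) = l2_norm (y - x).
Proof. by apply: (@of_real_inj R k); rewrite -!l2_normE distrC. Qed.

(** The limit is taken coordinatewise along an ultrafilter. Cauchy bounds on finitely many
    coordinates pass to it, and show both that it lies in l_2 and that convergence is in norm. *)
Lemma l2_complete (F : set_system l2) : ProperFilter F -> cauchy F -> cvg F.
Proof.
move=> FF /cauchyP Fc.
have {}Fc (e : R) : 0 < e -> exists y : l2, F (fun z => l2_norm (z - y) < e).
  move=> e0; have := Fc (of_real k e); rewrite -{1}(of_real0 R k) lt_of_real => /(_ e0)[y Fy].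
  exists y; apply: filterS Fy => z.
  by rewrite -ball_normE /= l2_normE lt_of_real l2_normBC.
have [U [UU FU]] := ultraFilterLemma FF.
have lim i : exists l : K^o, (fun z : l2 => z i : K^o) @ U --> l.
  have [y Fy] := Fc 1 ltr01.
  apply: (@bounded_ultra_cvg _ _ _ U UU _ (l2_norm y + 1)).
  apply: filterS (FU _ Fy) => z zy.
  have h1 := le_l2_norm_coord (z - y) i; rewrite l2B in h1.
  have h2 := le_modulus_sub (z i) (y i).
  have h3 := le_l2_norm_coord y i.
  by rewrite (le_trans h2) // lerD // (le_trans h1) // ltW.
have [x0 x0P] := choice lim.
have close (e : R) (y : l2) : 0 < e -> F (fun z => l2_norm (z - y) < e) ->
    forall J, sqsum J ((y : I -> K^o) - x0) <= e ^+ 2.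
  move=> e0 Fy J.
  have cv i : (fun z : l2 => modulus (y i - z i)) @ U --> modulus (y i - x0 i).
    apply/cvgrPdist_lt => d d0; have /cvg_modulusP/(_ d d0) := x0P i.
    apply: filterS => z zd; apply: le_lt_trans zd.
    have h1 := le_modulusB (y i) (z i) (x0 i).
    have h2 := le_modulusB (y i) (x0 i) (z i).
    rewrite [modulus (x0 i - _)]modulusBC in h2.
    by rewrite ler_distl; apply/andP; split; lra.
  have cs : (fun z : l2 => \sum_(i <- J) modulus (y i - z i) ^+ 2) @ U --> sqsum J ((y : I -> K^o) - x0).
    apply: cvg_big => [|i _].
      exact: add_continuous.
    by under eq_fun do rewrite expr2; rewrite expr2; apply: cvgM; exact: cv.
  apply: (cvgr_to_le cs); apply: filterS (FU _ Fy) => z /= zy.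
  apply: (@le_trans _ _ (l2_norm (y - z) ^+ 2)); first exact: (le_l2_norm (y - z) J).
  by rewrite ler_sqr ?nnegrE ?l2_norm_ge0 ?(ltW e0) // l2_normBC ltW.
have x0l2 : x0 \in l2_fun.
  have [y Fy] := Fc 1 ltr01.
  have -> : x0 = (y : I -> K^o) - ((y : I -> K^o) - x0) by rewrite opprB addrC subrK.
  apply: rpredB; first exact: valP.
  by apply: mem_set; exists (1 ^+ 2); exact: close.
apply/cvg_ex; exists (MkL2 x0l2); apply/cvgrPdist_lt => _ /gt0_of_real[e e0 ->].
have e2 : 0 < e / 2 by rewrite divr_gt0.
have [y Fy] := Fc _ e2; apply: filterS (Fy) => z zy.
have h : l2_norm (y - MkL2 x0l2) <= e / 2.
  by apply: l2_norm_le; [exact: ltW|exact: close].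
rewrite l2_normE lt_of_real l2_normBC -(subrKA y) (splitr e).
have := l2_normD (z - y) (y - MkL2 x0l2); rewrite -of_realD le_of_real.
by move/le_lt_trans; apply; rewrite ltr_leD.
Qed.

HB.instance Definition _ := Uniform_isComplete.Build l2 l2_complete.

Definition pdot J x y : K^o := \sum_(i <- J) x i * conj (y i).

(** The partial sums are bounded because |x_i y_i| <= |x_i|^2 + |y_i|^2. *)
Lemma pdot_cvg x y : exists l : K^o, (fun J => pdot J x y) @ @fset_ultra I --> l.
Proof.
apply: (@bounded_ultra_cvg _ _ _ _ (fset_ultra_ultra I) _ (l2_norm x ^+ 2 + l2_norm y ^+ 2)).
apply: filterE => J; rewrite (le_trans (modulus_sum _ _ _)) //.
apply: (@le_trans _ _ (sqsum J x + sqsum J y)); last by rewrite lerD // le_l2_norm.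
rewrite /sqsum -big_split /=; apply: ler_sum => i _.
rewrite modulusM modulus_conj.
have h1 := sqr_ge0 (modulus (x i) - modulus (y i)); rewrite sqrrB in h1.
have h2 := sqr_ge0 (modulus (x i)); have h3 := sqr_ge0 (modulus (y i)).
lra.
Qed.

Definition l2_dot x y : K := sval (cid (pdot_cvg x y)).

Lemma l2_dot_cvg x y : (fun J => pdot J x y) @ @fset_ultra I --> (l2_dot x y : K^o).
Proof. by rewrite /l2_dot; case: cid. Qed.

Lemma l2_dotP x y (l : K) : (fun J => pdot J x y) @ @fset_ultra I --> (l : K^o) -> l2_dot x y = l.
Proof. by apply: cvg_scalar_unique; exact: l2_dot_cvg. Qed.

Lemma l2_dot_hermitian x y : l2_dot x y = (-1) ^+ false * conj (l2_dot y x).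
Proof.
rewrite mul1r; apply: l2_dotP; apply/cvg_modulusP => e e0.
have /cvg_modulusP/(_ e e0) := @l2_dot_cvg y x; apply: filterS => J.
suff -> : pdot J x y = conj (pdot J y x) by rewrite -scalar_conjB modulus_conj.
rewrite /pdot (big_morph conj (@scalar_conjD R k) (@scalar_conj0 R k)).
by apply: eq_bigr => i _; rewrite scalar_conjM scalar_conjK mulrC.
Qed.

Lemma l2_dotBl z : zmod_morphism (l2_dot ^~ z).
Proof.
move=> x y; apply: l2_dotP.
have -> : (fun J => pdot J (x - y) z) = (fun J => pdot J x z - pdot J y z).
  by apply/funext => J; rewrite /pdot -sumrB; apply: eq_bigr => i _; rewrite l2B mulrBl.
by apply: cvgB; exact: l2_dot_cvg.
Qed.

Lemma l2_dotZl z : scalable_for *%R (l2_dot ^~ z).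
Proof.
move=> c x; apply: l2_dotP.
have -> : (fun J => pdot J (c *: x) z) = (fun J => c * pdot J x z).
  by apply/funext => J; rewrite /pdot mulr_sumr; apply: eq_bigr => i _; rewrite l2Z mulrA.
by apply: (@cvgM K); [exact: cvg_cst|exact: l2_dot_cvg].
Qed.

Lemma l2_dotBr z : zmod_morphism (l2_dot z).
Proof.
move=> x y; rewrite l2_dot_hermitian mul1r l2_dotBl scalar_conjB.
by rewrite [l2_dot z x]l2_dot_hermitian [l2_dot z y]l2_dot_hermitian !mul1r.
Qed.

Lemma l2_dotZr z : scalable_for (conj \; *%R) (l2_dot z).
Proof.
move=> c x; rewrite l2_dot_hermitian mul1r l2_dotZl scalar_conjM /=.
by rewrite [l2_dot z x]l2_dot_hermitian mul1r.
Qed.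

Lemma l2_norm_approx x (e : R) : 0 < e ->
  exists J, forall J', (J `<=` J')%fset -> l2_norm x ^+ 2 - e < sqsum J' x.
Proof.
move=> e0; have [_ [J _ <-] JP] := @sup_adherent _ _ e e0 (l2_has_sup x).
exists J => J' JJ'; rewrite sqr_sqrtr ?sup_sqsum_ge0 //.
exact: lt_le_trans JP (sqsum_subset _ JJ').
Qed.

Lemma l2_dotE x : `|x| ^+ 2 = l2_dot x x.
Proof.
rewrite l2_normE expr2 -of_realM -expr2; apply/esym/l2_dotP/cvg_modulusP => e e0.
have [J JP] := l2_norm_approx x e0.
have := fset_ultra_tail J; apply: filterS => J' /JP lt_sq.
have -> : pdot J' x x = of_real k (sqsum J' x).
  by rewrite of_real_sum; apply: eq_bigr => i _; rewrite scalar_mul_conj.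
rewrite -of_realN -of_realD modulus_of_real distrC ger0_norm ?subr_ge0 ?le_l2_norm //.
by rewrite ltrBlDl -ltrBlDr.
Qed.

HB.instance Definition _ :=
  isBilinear.Build K l2 l2 K *%R (conj \; *%R) l2_dot l2_dotBl l2_dotBr l2_dotZl l2_dotZr.
HB.instance Definition _ :=
  isHermitianSesquilinear.Build K l2 false conj l2_dot l2_dot_hermitian.

Lemma l2_dot_gt0 x : x != 0 -> 0 < l2_dot x x.
Proof. by move=> x0; rewrite -l2_dotE exprn_gt0 // normr_gt0. Qed.

HB.instance Definition _ := isDotProduct.Build K l2 l2_dot l2_dot_gt0.


End l2.

(** * Weak convergence in l_2(I) *)

Section l2_weak_convergence.
Variables (R : realType) (k : scalar_kind) (I : choiceType).
Local Notation K := (scalars R k).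
Local Notation conj := (@scalar_conj R k).
Local Notation l2 := (l2 R k I).
Implicit Types (J : {fset I}) (f : I -> K^o) (x y : l2) (phi : weak_dual l2).

Lemma l2_unit_subproof i : (fun j => (j == i)%:R : K^o) \in @l2_fun R k I.
Proof.
apply: mem_set; exists 1 => J.
have [iJ|iJ] := boolP (i \in J).
  rewrite /sqsum (big_fsetD1 i) //= eqxx modulus1 expr1n big_seq_cond big1 ?addr0 // => j.
  by rewrite andbT !inE => /andP[/negPf-> _]; rewrite modulus0 expr0n.
rewrite /sqsum big_seq_cond big1 // => j; rewrite andbT => jJ.
by case: eqVneq jJ iJ => [-> ->//|_ _ _]; rewrite modulus0 expr0n.
Qed.

Definition l2_unit i : l2 := MkL2 (l2_unit_subproof i).

Definition l2_restr J f : l2 := \sum_(i <- J) f i *: l2_unit i.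

Lemma l2_restrE J f j : l2_restr J f j = if j \in J then f j else 0.
Proof.
have uE i : l2_unit i j = (j == i)%:R by [].
rewrite /l2_restr l2_sum.
rewrite (eq_bigr (fun i => f i * (j == i)%:R)) => [|i _]; last by rewrite l2Z uE.
case: ifPn => jJ.
  rewrite (big_fsetD1 j) //= eqxx mulr1 big_seq_cond big1 ?addr0 // => i.
  by rewrite andbT !inE eq_sym => /andP[/negPf-> _]; rewrite mulr0.
rewrite big_seq_cond big1 // => i; rewrite andbT => iJ.
by case: eqVneq iJ jJ => [-> ->//|_ _ _]; rewrite mulr0.
Qed.

Lemma l2_restr_norm J f : l2_norm (l2_restr J f) <= Num.sqrt (sqsum J f).
Proof.
apply: l2_norm_le => [|J']; first exact: sqrtr_ge0.
rewrite sqr_sqrtr ?sqsum_ge0 //.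
apply: le_trans (sqsum_subset _ (fsubsetUr J J')) _.
rewrite /sqsum -(big_fset_incl _ (fsubsetUl J J')) => [|i _ iJ]; last first.
  by rewrite l2_restrE (negPf iJ) modulus0 expr0n.
rewrite le_eqVlt; apply/orP; left; apply/eqP.
rewrite big_seq_cond [RHS]big_seq_cond; apply: eq_bigr => i; rewrite andbT => iJ.
by rewrite l2_restrE iJ.
Qed.

Lemma l2_functional_restr phi J f :
  phi (l2_restr J f) = \sum_(i <- J) f i * phi (l2_unit i).
Proof. by rewrite functional_sum; apply: eq_bigr => i _; rewrite functionalZ. Qed.

Lemma l2_functional_bounded phi :
  exists2 M : R, 0 < M & forall x, modulus (phi x) <= M * l2_norm x.
Proof.
have [_ /gt0_of_real[C C0 ->] phiC] := weak_dual_bounded phi.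
by exists C => // x; rewrite -(le_of_real k) of_realM -modulusE -l2_normE.
Qed.

(* Testing [phi] on the vectors [conj a] truncated to [J] shows that its
   coefficients [a] are square summable. *)
Lemma l2_functional_coef phi : (fun i => phi (l2_unit i) : K^o) \in @l2_fun R k I.
Proof.
have [M M0 phiM] := l2_functional_bounded phi.
apply: mem_set; exists (M ^+ 2) => J; set a := (fun i => _); set S := sqsum J a.
have S0 : 0 <= S := sqsum_ge0 J a.
have ca : sqsum J (conj \o a) = S by apply: eq_bigr => i _; rewrite /= modulus_conj.
have phiS : phi (l2_restr J (conj \o a)) = of_real k S.
  rewrite l2_functional_restr of_real_sum; apply: eq_bigr => i _.
  by rewrite mulrC scalar_mul_conj.
have SM : S <= M * Num.sqrt S.
  have := phiM (l2_restr J (conj \o a)); rewrite phiS modulus_of_real ger0_norm //.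
  move/le_trans; apply; rewrite ler_pM2l // -ca; exact: l2_restr_norm.
have [->|Sn0] := eqVneq S 0; first by rewrite sqr_ge0.
have s0 : 0 < Num.sqrt S by rewrite sqrtr_gt0 lt_def Sn0.
have sM : Num.sqrt S <= M by rewrite -(ler_pM2r s0) -expr2 sqr_sqrtr.
by rewrite -[leLHS](sqr_sqrtr S0) ler_sqr ?nnegrE ?(ltW s0) ?(ltW M0).
Qed.

(** [J0] carries all but s^2 of the squared norm of the coefficients [a] of [phi]; outside it 2uv <=
    s u^2 + v^2 / s applies. The bound is thus uniform on bounded sets of [x]. *)
Lemma l2_functional_tail phi (s : R) : 0 < s -> exists J0, forall x,
  modulus (phi x - phi (l2_restr J0 x)) <= s * (l2_norm x ^+ 2 + 1).
Proof.
move=> s0; pose a : l2 := MkL2 (l2_functional_coef phi).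
have [J0 J0P] := l2_norm_approx a (exprn_gt0 2 s0).
have [M M0 phiM] := l2_functional_bounded phi.
exists J0 => x; apply/ler_addgt0Pr => e e0.
have e2 : 0 < (e / M) ^+ 2 by rewrite exprn_gt0 // divr_gt0.
(* [J1] depends on [x] and only replaces [x] by a finitely supported vector, up to the arbitrary
   error [e]. *)
have [J1 J1P] := l2_norm_approx x e2.
pose J := (J0 `|` J1)%fset.
have h1 : modulus (phi x - phi (l2_restr J x)) <= e.
  rewrite -functionalB; apply: le_trans (phiM _) _; rewrite mulrC -ler_pdivlMr //.
  apply: l2_norm_le => [|J']; first by rewrite ltW // divr_gt0.
  have := J1P J (fsubsetUr J0 J1); rewrite ltrBlDr -ltrBlDl => lt_e.
  apply: le_trans (ltW lt_e); rewrite lerBrDl.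
  apply: le_trans (le_l2_norm x (J `|` J')%fset).
  apply: le_trans (lerD (lexx _) (sqsum_subset _ (fsubsetUr J J'))) _.
  rewrite /sqsum !(big_fset_subset _ (fsubsetUl J J')).
  have -> : \sum_(i <- J) modulus ((x - l2_restr J x) i) ^+ 2 = 0.
    rewrite big_seq_cond big1 // => i; rewrite andbT l2B l2_restrE => ->.
    by rewrite subrr modulus0 expr0n.
  rewrite add0r.
  rewrite lerD2l le_eqVlt; apply/orP; left; apply/eqP.
  rewrite big_seq_cond [RHS]big_seq_cond; apply: eq_bigr => i; rewrite andbT.
  by rewrite in_fsetD => /andP[iJ _]; rewrite l2B l2_restrE (negPf iJ) subr0.
have h2 : modulus (phi (l2_restr J x) - phi (l2_restr J0 x)) <= s * (l2_norm x ^+ 2 + 1).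
  rewrite !l2_functional_restr (big_fset_subset _ (fsubsetUl J0 J1)) addrAC subrr add0r.
  apply: le_trans (modulus_sum _ _ _) _.
  apply: (@le_trans _ _ (s * sqsum (J `\` J0)%fset x + s^-1 * sqsum (J `\` J0)%fset a)).
    rewrite /sqsum !mulr_sumr -big_split /=; apply: ler_sum => i _.
    rewrite modulusM -[phi (l2_unit i)]/(a i).
    set u := modulus (x i); set v := modulus (a i).
    have u0 : 0 <= u := modulus_ge0 _; have v0 : 0 <= v := modulus_ge0 _.
    apply: (@le_trans _ _ (2 * (u * v))); first by rewrite ler_peMl ?mulr_ge0 // ler1n.
    rewrite -subr_ge0; have -> : s * u ^+ 2 + s^-1 * v ^+ 2 - 2 * (u * v) =
        (s * u - v) ^+ 2 / s by field; rewrite gt_eqF.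
    by rewrite divr_ge0 ?sqr_ge0 // ltW.
  rewrite mulrDr lerD //.
    by rewrite ler_pM2l // le_l2_norm.
  rewrite mulr1 mulrC ler_pdivrMr // -expr2.
  have := J0P J (fsubsetUl J0 J1); have := le_l2_norm a J.
  have := J0P J0 (fsubset_refl _).
  rewrite {2 3}/sqsum (big_fset_subset _ (fsubsetUl J0 J1)) -!/(sqsum _ _).
  lra.
have h3 := le_modulusB (phi x) (phi (l2_restr J x)) (phi (l2_restr J0 x)).
by rewrite (le_trans h3) // addrC lerD.
Qed.

(** On a bounded set [phi] is uniformly close to a combination of finitely many coordinates; (C +
    C)^2 + 1 bounds |h t - l|^2 + 1. *)
Lemma l2_weak_cvg (X : Type) (F : set_system X) {FF : Filter F} (h : X -> l2) (l : l2) (C : R) :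
  (forall t, l2_norm (h t) <= C) -> l2_norm l <= C ->
  (forall i, (fun t => h t i : K^o) @ F --> (l i : K^o)) ->
  (h : X -> weak_space l2) @ F --> (l : weak_space l2).
Proof.
move=> hC lC hl; apply/cvg_weak_space => phi; apply/cvg_modulusP => e e0.
have C0 : 0 <= C := le_trans (l2_norm_ge0 l) lC.
have D0 : 0 < (C + C) ^+ 2 + 1 by rewrite ltr_wpDl ?sqr_ge0.
have s0 : 0 < e / 2 / ((C + C) ^+ 2 + 1) by rewrite !divr_gt0.
have [J JP] := l2_functional_tail phi s0.
have cv : (fun t => \sum_(i <- J) (h t i - l i) * phi (l2_unit i) : K^o) @ F -->
    (\sum_(i <- J) 0 * phi (l2_unit i) : K^o).
  apply: cvg_big => [|i _]; first exact: add_continuous.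
  apply: (@cvgM K); last exact: cvg_cst.
  by rewrite -(subrr (l i)); apply: cvgB; [exact: hl|exact: cvg_cst].
have e2 : 0 < e / 2 by rewrite divr_gt0.
move/cvg_modulusP: cv => /(_ _ e2); apply: filterS => t.
rewrite [X in _ - X]big1 ?subr0 => [|i _]; last by rewrite mul0r.
rewrite -[\sum_(i <- J) _](@l2_functional_restr phi J (h t - l)) => ht.
rewrite -functionalB (splitr e).
have h1 := le_modulus_sub (phi (h t - l)) (phi (l2_restr J (h t - l))).
apply: le_lt_trans h1 _; rewrite ltr_leD //; apply: le_trans (JP _) _.
rewrite mulrAC ler_pdivrMr // ler_pM2l // lerD2r.
rewrite ler_sqr ?nnegrE ?l2_norm_ge0 ?addr_ge0 //.
have := l2_normD (h t) (- l); rewrite -of_realD le_of_real => /le_trans; apply.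
rewrite lerD //; suff -> : l2_norm (- l) = l2_norm l by [].
by apply: (@of_real_inj R k); rewrite -!l2_normE normrN.
Qed.

Lemma l2_coord_linear i : linear (fun x : l2 => x i : K^o).
Proof. by []. Qed.

Lemma l2_coord_bound i x : `|x i : K| <= 1 * `|x|.
Proof. by rewrite mul1r l2_normE modulusE le_of_real le_l2_norm_coord. Qed.

Definition l2_coord i : weak_dual l2 :=
  WeakDual (bounded_linear_functional ler01 (l2_coord_linear i) (l2_coord_bound i)).

Lemma weak_l2_hausdorff : hausdorff_space (weak_space l2).
Proof.
move=> x y xy; apply: val_inj; apply/funext => i.
apply/eqP; rewrite -subr_eq0; apply/eqP/modulus0_eq0/eqP.
rewrite eq_le modulus_ge0 andbT; apply/ler_addgt0Pr => e e0; rewrite add0r.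
have e2 : 0 < e / 2 by rewrite divr_gt0.
have near_coord (z : weak_space l2) :
    nbhs z [set w : weak_space l2 | modulus ((w : l2) i - (z : l2) i) < e / 2].
  have [H _] := @cvg_weak_space _ _ _ (nbhs z) _ id z.
  by have /cvg_modulusP/(_ _ e2) := H cvg_id (l2_coord i).
have [w [/= wx wy]] := xy _ _ (near_coord x) (near_coord y).
rewrite (le_trans (le_modulusB _ ((w : l2) i) _)) // modulusBC (splitr e).
by rewrite lerD // ltW.
Qed.

End l2_weak_convergence.

(** * Embedding into l_2(omega_1) *)

Lemma sum_half_powers_le (R : realType) (s : seq nat) : uniq s ->
  \sum_(m <- s) (1 / 2 : R) ^+ m <= 2.
Proof.
move=> us; pose N := (\max_(m <- s) m).+1.
have geo n : \sum_(m <- iota 0 n) (1 / 2 : R) ^+ m = 2 - 2 * (1 / 2) ^+ n.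
  elim: n => [|n IH]; first by rewrite big_nil expr0 mulr1 subrr.
  by rewrite -addn1 iotaD big_cat /= big_seq1 IH add0n addn1 exprS; field.
have p0 m : 0 <= (1 / 2 : R) ^+ m by rewrite exprn_ge0 // divr_ge0.
apply: (@le_trans _ _ (\sum_(m <- iota 0 N) (1 / 2 : R) ^+ m)); last first.
  by rewrite geo gerBl mulr_ge0.
rewrite [leRHS](bigID (mem s)) /= -[X in X + _]big_filter.
rewrite (perm_big [seq i <- iota 0 N | mem s i]).
  by rewrite lerDl sumr_ge0.
apply: uniq_perm => // [|m]; first by rewrite filter_uniq // iota_uniq.
rewrite mem_filter mem_iota add0n leq0n /=; case ms : (m \in s) => //.
by rewrite /N ltnS; apply/esym; exact: leq_bigmax_seq.
Qed.

(** * Continuous injections of compact sets into Hausdorff spaces *)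

Section compact_image.
Variables (X Y : topologicalType) (A : set X) (f : X -> Y).
Hypotheses (cA : compact A) (hY : hausdorff_space Y).
Hypotheses (f_cont : continuous (fun x : A => f (set_val x))) (f_inj : set_inj A f).

(** Relatively closed parts of [A] are compact, so their images are closed in the Hausdorff space
    [Y], which is continuity of the inverse. *)
Lemma compact_image_homeomorphic : compact (f @` A) /\ homeomorphic A (f @` A).
Proof.
have f_within : {within A, continuous f} by apply/subspace_sigL_continuousP.
split; first exact: continuous_compact.
have fA (x : A) : (f @` A) (f (set_val x)) by exists (set_val x) => //; exact: set_mem (valP x).
pose F (x : A) : (f @` A : set Y) := exist _ (f (set_val x)) (mem_set (fA x)).
have ex (y : (f @` A : set Y)) : exists x : A, f (set_val x) = set_val y.
  have [x Ax xy] := set_mem (valP y).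
  by exists (exist _ x (mem_set Ax)).
have [G GP] := choice ex.
have GK : cancel G F by move=> y; apply: val_inj; exact: GP.
have FK : cancel F G.
  by move=> x; apply: val_inj; apply: f_inj; [exact: valP|exact: valP|exact: GP].
exists F, G; split=> //; first by apply: continuous_comp_initial; exact: f_cont.
apply/continuousP => _ [V oV <-].
have cB : compact (f @` (A `&` ~` V)).
  apply: continuous_compact; last by apply: compact_closedI; [|exact: open_closedC].
  by apply: continuous_subspaceW f_within => x [].
exists (~` (f @` (A `&` ~` V))); first by apply: closed_openC; exact: compact_closed.
apply/seteqP; split=> y /=.
  move=> nyV; apply: contrapT => GyV; apply: nyV; exists (set_val (G y)) => //.
  by split=> //; exact: set_mem (valP (G y)).
move=> GyV [x [Ax nVx] xy]; apply: nVx; suff -> : x = set_val (G y) by [].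
by apply: f_inj; [exact: mem_set|exact: valP|rewrite GP].
Qed.

End compact_image.

(** * Block functions of a club and the embedding they define *)

Section hilbert_embedding.
Variables (R : realType) (k : scalar_kind).
Local Notation K := (scalars R k).
Local Notation C0 := (C0 R k).
Local Notation step := (step R k).
Implicit Types (mu nu : weak_dual C0) (a b c d g x : omega1).
Local Open Scope order_scope.

Variable D : set omega1.
Hypothesis clubD : club D.

Definition pred_in (p g : omega1) := [/\ D p, p < g & forall q, D q -> q < g -> q <= p].

(** The indicator of ]p, g] for the predecessor [p] of [g] in [D], of [0, g] if [D] has nothing
    below [g], and 0 if the elements of [D] below [g] have no greatest one. *)
Lemma block_function g : exists v : C0,
  [/\ (forall q, D q -> ~ q < g) -> v = step g,
      forall p, pred_in p g -> v = step g - step p,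
      forall x, modulus (v x) <= 1 &
      forall x, v x != 0 -> x <= g /\ forall q, D q -> q < g -> q < x].
Proof.
have [[p pg]|/forallNP np] := pselect (exists p, pred_in p g).
  have [Dp ltpg pmax] := pg; exists (step g - step p); split=> [nD|p' [Dp' p'g p'max]|x|x].
  - by case: (nD p).
  - suff -> : p = p' by [].
    by apply/eqP; rewrite eq_le pmax // p'max.
  - rewrite C0B !stepE; have [xp|px] := leP x p.
      by rewrite (le_trans xp (ltW ltpg)) subrr modulus0 ler01.
    by rewrite subr0; case: (x <= g); rewrite ?modulus1 ?modulus0 ?ler01.
  - rewrite C0B !stepE; have [xp|px] := leP x p.
      by rewrite (le_trans xp (ltW ltpg)) subrr eqxx.
    rewrite subr0; case: (leP x g) => [xg _|_]; last by rewrite eqxx.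
    by split=> // q Dq qg; exact: le_lt_trans (pmax q Dq qg) px.
have [nD|nnD] := pselect (forall q, D q -> ~ q < g).
  exists (step g); split=> // [p /np//|x|x]; rewrite stepE.
    by case: (x <= g); rewrite ?modulus1 ?modulus0 ?ler01.
  case: (leP x g) => [xg _|_]; last by rewrite eqxx.
  by split=> // q /nD.
exists 0; split=> // [p /np//|x|x]; first by rewrite modulus0 ler01.
by rewrite eqxx.
Qed.

Definition block g : C0 := sval (cid (block_function g)).

Lemma blockP g : [/\ (forall q, D q -> ~ q < g) -> block g = step g,
      forall p, pred_in p g -> block g = step g - step p,
      forall x, modulus (block g x) <= 1 &
      forall x, block g x != 0 -> x <= g /\ forall q, D q -> q < g -> q < x].
Proof. by rewrite /block; case: cid. Qed.

(** Blocks that share a point [x] have the same next element [nx x] of [D], so their indices lie in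
    one countable initial segment, whose enumeration numbers them. *)
Lemma block_index : exists idx : omega1 -> nat, forall x g h,
  block g x != 0 -> block h x != 0 -> idx g = idx h -> g = h.
Proof.
have inj b : exists f : omega1 -> nat, forall g h, g <= b -> h <= b -> f g = f h -> g = h.
  have /countable_injP[f finj] := omega1_countable b.
  by exists f => g h gb hb; apply: finj; exact: mem_set.
have [iota iotaP] := choice inj.
have next g : exists d, [/\ D d, g <= d & forall q, D q -> g <= q -> d <= q].
  have [d [Dd gd] _] := club_next g clubD.
  have [|d' [Dd' gd'] dmin] := @omega1_wf [set d | D d /\ g <= d].
    by exists d; split=> //; exact: ltW.
  by exists d'; split=> // q Dq gq; exact: dmin.
have [nx nxP] := choice next.
have nxE x g : block g x != 0 -> nx g = nx x.
  have [_ _ _ bP] := blockP g; move=> /bP[xg xD].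
  have [Dx xx xmin] := nxP x; have [Dg gg gmin] := nxP g.
  apply/eqP; rewrite eq_le gmin //=; last first.
    rewrite leNgt; apply/negP => xg'; have := xD _ Dx xg'.
    by rewrite ltNge xx.
  by apply: xmin => //; exact: le_trans xg gg.
exists (fun g => iota (nx g) g) => x g h gx hx.
rewrite (nxE x) // (nxE x h) //; apply: iotaP.
  by rewrite -(nxE x g gx); have [] := nxP g.
by rewrite -(nxE x h hx); have [] := nxP h.
Qed.

Definition idx : omega1 -> nat := sval (cid block_index).

Definition wblock g : C0 := of_real k ((1 / 2) ^+ idx g) *: block g.

Lemma wblockE g x : wblock g x = of_real k ((1 / 2) ^+ idx g) * block g x.
Proof. by []. Qed.

Local Close Scope order_scope.

Lemma half_pow_gt0 n : 0 < (1 / 2 : R) ^+ n.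
Proof. by rewrite exprn_gt0 // divr_gt0. Qed.

(** The blocks alive at [x] have distinct numbers, so their weights are distinct terms of a
    geometric series. *)
Lemma sum_wblock_le (J : {fset omega1}) x : \sum_(g <- J) modulus (wblock g x) <= 2.
Proof.
have -> : \sum_(g <- J) modulus (wblock g x) =
    \sum_(g <- J | block g x != 0) modulus (wblock g x).
  rewrite [RHS]big_mkcond; apply: eq_bigr => g _; case: ifPn => // /negPn/eqP gx.
  by rewrite wblockE gx mulr0 modulus0.
apply: (@le_trans _ _ (\sum_(g <- J | block g x != 0) (1 / 2) ^+ idx g)).
  apply: ler_sum => g _; rewrite wblockE modulusM modulus_of_real gtr0_norm ?half_pow_gt0 //.
  by rewrite ler_piMr ?(ltW (half_pow_gt0 _)) //; have [] := blockP g.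
rewrite -big_filter -(big_map idx xpredT (fun m => (1 / 2) ^+ m)).
apply: sum_half_powers_le; rewrite map_inj_in_uniq ?filter_uniq ?fset_uniq //.
move=> g h; rewrite !mem_filter => /andP[gx _] /andP[hx _].
exact: (svalP (cid block_index)) gx hx.
Qed.

(** [mu] is tested on the combination of the weighted blocks with phases [s], whose sup norm is at
    most 2. *)
Lemma sum_functional_wblock_le (J : {fset omega1}) mu (C : R) : 0 <= C ->
  (forall f : C0, modulus (mu f) <= C * sup_norm f) ->
  \sum_(g <- J) modulus (mu (wblock g)) <= C * 2.
Proof.
move=> C0 muC; have [s sP] := choice (fun g => @scalar_signP R k (mu (wblock g))).
pose f : Defs.C0 R k := \sum_(g <- J) s g *: wblock g.
have fE : mu f = of_real k (\sum_(g <- J) modulus (mu (wblock g))).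
  rewrite functional_sum of_real_sum; apply: eq_bigr => g _.
  by rewrite functionalZ; have [] := sP g.
have : modulus (mu f) <= C * 2.
  apply: le_trans (muC f) _; rewrite ler_wpM2l //; apply: sup_norm_le => x.
  rewrite C0_sum; apply: le_trans (modulus_sum _ _ _) _.
  apply: le_trans (sum_wblock_le J x); apply: ler_sum => g _.
  rewrite C0Z modulusM ler_piMl ?modulus_ge0 //; by have [] := sP g.
by rewrite fE modulus_of_real ger0_norm // sumr_ge0 // => g _; exact: modulus_ge0.
Qed.

Lemma sqsum_functional_le (J : {fset omega1}) mu (C : R) : 0 <= C ->
  (forall f : C0, modulus (mu f) <= C * sup_norm f) ->
  sqsum J (fun g => mu (wblock g)) <= (C * 2) ^+ 2.
Proof.
move=> C0 muC.
have one g : modulus (mu (wblock g)) <= C * 2.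
  have := @sum_functional_wblock_le [fset g]%fset mu C C0 muC.
  by rewrite big_seq_fset1.
apply: (@le_trans _ _ (\sum_(g <- J) C * 2 * modulus (mu (wblock g)))).
  by apply: ler_sum => g _; rewrite expr2 ler_wpM2r ?modulus_ge0.
rewrite -mulr_sumr expr2 ler_wpM2l ?mulr_ge0 //.
exact: sum_functional_wblock_le.
Qed.

Lemma embed_subproof mu : (fun g => mu (wblock g) : K^o) \in @l2_fun R k omega1.
Proof.
have [C C0 muC] := C0_functional_bounded mu.
apply: mem_set; exists ((C * 2) ^+ 2) => J.
by apply: sqsum_functional_le => //; exact: ltW.
Qed.

Definition embed mu : l2 R k omega1 := MkL2 (embed_subproof mu).

Lemma embed_norm_le mu (C : R) : 0 <= C ->
  (forall f : C0, modulus (mu f) <= C * sup_norm f) -> l2_norm (embed mu) <= C * 2.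
Proof.
move=> C0 muC; apply: l2_norm_le => [|J]; first by rewrite mulr_ge0.
exact: sqsum_functional_le.
Qed.

Variable A : set (weak_dual C0).
Hypothesis cA : compact A.
(* [mu] of [d, omega1) vanishes: the total mass is approached below every [d] in [D]. *)
Hypothesis flat : forall d mu t (e : R) b, D d -> A mu -> step_tot mu t ->
  0 < e -> (b < d)%O -> exists c, [/\ (b <= c)%O, (c < d)%O & modulus (t - mu (step c)) < e].

(** By flatness both functionals come close to their totals in [b, d), perhaps at different points
    [c] and [c']; [step_cauchy] makes the change from [c] to [c'] harmless. *)
Lemma flat_difference d b mu nu tm tn (kappa : K) : D d -> (b < d)%O ->
  A mu -> A nu -> step_tot mu tm -> step_tot nu tn ->
  (forall c, (b <= c)%O -> (c < d)%O -> mu (step c) - nu (step c) = kappa) ->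
  tm - tn = kappa.
Proof.
move=> Dd bd Amu Anu mt nt H; apply/eqP; rewrite -subr_eq0; apply/eqP.
apply: modulus0_eq0; apply/eqP; rewrite eq_le modulus_ge0 andbT.
apply/ler_addgt0Pr => e e0; rewrite add0r.
have e3 : 0 < e / 3 by rewrite divr_gt0.
have [|b' [/= bb' b'd] osc] := @step_cauchy _ _ mu [set c | (b <= c)%O /\ (c < d)%O] (e / 3) _ e3.
  by exists b => /=; rewrite lexx.
have [c [b'c cd tc]] := flat Dd Amu mt e3 b'd.
have [c' [b'c' c'd tc']] := flat Dd Anu nt e3 b'd.
have h1 := osc c c' (conj (le_trans bb' b'c) cd) (conj (le_trans bb' b'c') c'd) b'c b'c'.
have <- := H c' (le_trans bb' b'c') c'd.
have -> : tm - tn - (mu (step c') - nu (step c')) =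
    (tm - mu (step c)) + (mu (step c) - mu (step c')) - (tn - nu (step c')) by ring.
have h2 := le_modulusB (tm - mu (step c) + (mu (step c) - mu (step c'))) 0 (tn - nu (step c')).
rewrite subr0 sub0r modulusN in h2.
have h3 := le_modulusD (tm - mu (step c)) (mu (step c) - mu (step c')).
apply: le_trans h2 _; apply: (@le_trans _ _ (e / 3 + e / 3 + e / 3)).
  by apply: lerD (ltW tc'); apply: le_trans h3 _; exact: lerD (ltW tc) h1.
by rewrite le_eqVlt; apply/orP; left; apply/eqP; field.
Qed.

(** Induction on [g]: a block yields the step at [g] or its increment from the predecessor in [D].
    At a limit [g] of [D] the block gives no information, and flatness at [g] and at the next
    element of [D] decides. *)
Lemma embed_inj mu nu : A mu -> A nu -> embed mu = embed nu -> mu = nu.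
Proof.
move=> Amu Anu mn; apply: weak_dual_step_ext => g.
have bl h : mu (block h) = nu (block h).
  have := congr1 (fun x : l2 R k omega1 => x h) mn; rewrite /= !functionalZ.
  apply: mulfI; rewrite -(of_real0 R k) (inj_eq (@of_real_inj R k)).
  by rewrite gt_eqF // half_pow_gt0.
have [tm mt] := step_total mu; have [tn nt] := step_total nu.
elim/omega1_ind: g => g IH.
have [b1 b2 _ _] := blockP g.
have [nD|] := pselect (forall q, D q -> ~ (q < g)%O); first by rewrite -b1.
move=> /existsNP[q0 /not_implyP[Dq0 /contrapT q0g]].
have [[p pg]|/forallNP np] := pselect (exists p, pred_in p g).
  have := bl g; rewrite (b2 p pg) !functionalB (IH p); last by case: pg.
  by move/addIr.
(* If some ]b, g] missed [D], the supremum [s <= b] of the elements of [D] below [g] would belong to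
   the closed set [D] and be the predecessor of [g]. *)
have Dg : D g.
  have [clD _] := clubD; apply: (clD) => V /omega1_nbhsP[_ []]; first by exists q0.
  move=> b bg bV; apply: contrapT => nq.
  have big q : D q -> (q < g)%O -> (q <= b)%O.
    move=> Dq qg; rewrite leNgt; apply/negP => bq; apply: nq.
    by exists q; split=> //; apply: bV => //; exact: ltW.
  have [|s [sub _] smin] := @omega1_wf [set s | (forall q, D q -> (q < g)%O -> (q <= s)%O) /\ (s <= b)%O].
    by exists b.
  have sb : (s <= b)%O by exact: smin (conj big (lexx b)).
  apply: (np s); split=> //.
    apply: (clD) => W /omega1_nbhsP[Ws Wb].
    have [ex|nex] := pselect (exists z, (z < s)%O); last first.
      exists q0; split=> //; suff -> : q0 = s by [].
      apply/eqP; rewrite eq_le sub //= leNgt; apply/negP => q0s; apply: nex.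
      by exists q0.
    have [w ws wW] := Wb ex.
    apply: contrapT => nW; move: (ws); rewrite ltNge => /negP; apply.
    apply: smin; split; last exact: le_trans (ltW ws) sb.
    move=> q Dq qg; rewrite leNgt; apply/negP => wq; apply: nW; exists q; split=> //.
    by apply: wW => //; exact: sub.
  exact: le_lt_trans sb bg.
(* Below [g] the steps agree by induction, so by flatness at [g] the total masses agree. *)
have teq : tm - tn = 0.
  apply: (flat_difference Dg q0g Amu Anu mt nt) => c _ cg.
  by rewrite IH // subrr.
have [d [Dd gd] dmin] := club_next g clubD.
(* Points strictly between [g] and the next element [d] of [D] have predecessor [g], so equal blocks
   keep the difference of the steps constant on [g, d), and flatness at [d] applies. *)
have : tm - tn = mu (step g) - nu (step g).
  apply: (flat_difference Dd gd Amu Anu mt nt) => c; rewrite le_eqVlt => /orP[/eqP->//|gc] cd.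
  have [_ bc _ _] := blockP c.
  have gP : pred_in g c.
    split=> // q Dq qc; rewrite leNgt; apply/negP => gq.
    by have := dmin q Dq gq; rewrite leNgt (lt_trans qc cd).
  have := bl c; rewrite (bc g gP) !functionalB => e.
  have -> : mu (step c) - nu (step c) = (mu (step c) - mu (step g)) -
      (nu (step c) - nu (step g)) + (mu (step g) - nu (step g)) by ring.
  by rewrite e subrr add0r.
by rewrite teq => /esym/eqP; rewrite subr_eq0 => /eqP.
Qed.

Lemma embed_uniformly_eberlein : uniformly_eberlein_compact R k A.
Proof.
have [C C0 AC] := compact_uniformly_bounded cA.
have fc : continuous (fun mu : A => embed (set_val mu) : weak_space (l2 R k omega1)).
  move=> mu; apply: (@l2_weak_cvg R k omega1 A (nbhs mu) _ (fun mu : A => embed (set_val mu)) _ (C * 2)).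
  - by move=> nu; apply: embed_norm_le (ltW C0) _ => f; apply: AC; exact: set_mem (valP nu).
  - by apply: embed_norm_le (ltW C0) _ => f; apply: AC; exact: set_mem (valP mu).
  - move=> g; apply: (@continuous_comp _ _ _ (set_val : A -> weak_dual (Defs.C0 R k))
      (fun nu : weak_dual (Defs.C0 R k) => nu (wblock g) : K^o) mu).
      exact: initial_continuous.
    exact: weak_dual_eval_continuous.
have finj : set_inj A (embed : _ -> weak_space (l2 R k omega1)).
  by move=> mu nu /set_mem Amu /set_mem Anu; exact: embed_inj.
have [cI hI] := compact_image_homeomorphic cA (@weak_l2_hausdorff R k omega1) fc finj.
exists (l2 R k omega1), (@l2_dot R k omega1), (embed @` A); split=> //.
exact: l2_dotE.
Qed.

End hilbert_embedding.

(** * The dichotomy and the exclusion of both alternatives at once *)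

Section alternatives.
Variables (R : realType) (k : scalar_kind) (A : set (weak_dual (C0 R k))).

Lemma eberlein_or_delta_copy : compact A ->
  uniformly_eberlein_compact R k A \/ contains_delta_copy A.
Proof.
move=> cA.
have [[e [b [e0 drift]]]|nodrift] := pselect (exists (e : R) b, 0 < e /\
    forall a, exists mu t, [/\ A mu, step_tot mu t & forall c, (b <= c)%O -> (c < a)%O ->
      e <= modulus (t - mu (step R k c))]).
  by right; exact: (contains_delta_copy_of_drift cA e0 drift).
left.
(* Absence of drift for 1 / (n + 1) and [b]: some [a] is such that every functional of [A] comes
   this close to its total mass within [b, a). *)
have stable (p : nat * omega1) : exists a, forall mu t, A mu -> step_tot mu t ->
    exists c, [/\ (p.2 <= c)%O, (c < a)%O & modulus (t - mu (step R k c)) < p.1.+1%:R^-1].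
  apply: contrapT => na; apply: nodrift; exists p.1.+1%:R^-1, p.2.
  split=> [|a]; first by rewrite invr_gt0.
  apply: contrapT => nmu; apply: na; exists a => mu t Amu mt.
  apply: contrapT => nc; apply: nmu; exists mu, t; split=> // c bc ca.
  by rewrite leNgt; apply/negP => h; apply: nc; exists c.
have [g gP] := choice stable.
(* [Phi b] bounds these [a] for all [n] at once, so every point closed under [Phi] satisfies the
   flatness hypothesis of the embedding. *)
have [Phi PhiP] := choice (fun b => omega1_seq_ubound (fun n => g (n, b))).
have [w0 _] := omega1_nonempty.
apply: (@embed_uniformly_eberlein R k _ (closing_club Phi w0) A cA).
move=> d mu t e b [_ dP] Amu mt e0 bd.
pose n := Num.truncn e^-1.
have [c [bc cg tc]] := gP (n, b) mu t Amu mt; exists c; split=> //.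
  exact: lt_le_trans cg (le_trans (PhiP b n) (ltW (dP b bd))).
by apply: lt_trans tc _; rewrite invf_plt ?posrE // truncnS_gt.
Qed.

(** The homeomorphism onto the copy, followed by that of [A] with a weakly compact set, is a weakly
    continuous injection of [0, omega_1] into a Hilbert space. *)
Lemma eberlein_no_delta_copy :
  uniformly_eberlein_compact R k A -> ~ contains_delta_copy A.
Proof.
move=> [H [dot [B [dotE cB [F [G [FK GK Fc Gc]]]]]]].
move=> [rho [lambda [D [l0 cD sub [f [g [fK gK fc gc]]]]]]].
have inA (x : omega1_top) : A (set_val (f x)) by apply: sub; exact: set_mem (valP (f x)).
pose h (x : omega1_top) : A := exist _ (set_val (f x)) (mem_set (inA x)).
have hc : continuous h.
  apply: continuous_comp_initial => x.
  by apply: (@continuous_comp _ _ _ f set_val x); [exact: fc|exact: initial_continuous].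
apply: (@no_omega1_top_in_weak_space R k H dot dotE (fun x => set_val (F (h x)))).
  move=> x; apply: (@continuous_comp _ _ _ h (fun y => set_val (F y)) x); first exact: hc.
  by apply: (@continuous_comp _ _ _ F set_val); [exact: Fc|exact: initial_continuous].
move=> x y /val_inj/(can_inj FK) hxy; apply: (can_inj fK); apply: val_inj.
by have := congr1 val hxy.
Qed.

End alternatives.

Theorem theorem1p1 (R : realType) (k : scalar_kind)
    (K : set (weak_dual (C0 R k))) (hK : compact K) :
  (uniformly_eberlein_compact R k K /\ ~ contains_delta_copy K) \/
  (~ uniformly_eberlein_compact R k K /\ contains_delta_copy K).
Proof.
have [uK|cK] := eberlein_or_delta_copy hK; [left|right]; split=> //.
- exact: eberlein_no_delta_copy.
- by move=> /eberlein_no_delta_copy.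
Qed.
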